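(* Let $X$ be a martingale which is an almost-continuous diffusion, let $g:\mathbb{R}\to\mathbb{R}$ be a convex and Lipschitz continuous function, and choose any $T\in\mathbb{R}_+$. Then there exists a function $f:[0,T]\times\mathbb{R}\to\mathbb{R}$ such that $f(t,x)$ is convex in $x$, decreasing in $t$, and $$f(t,X_t)=\mathbb{E}[g(X_T)\mid\mathcal{F}_t]\quad\text{almost surely}$$ for every $t\in[0,T]$.
   Context: All processes are indexed by $t\in\mathbb{R}_+=[0,\infty)$ and are defined with respect to a filtered probability space $(\Omega,\mathcal{F},(\mathcal{F}_t)_{t\in\mathbb{R}_+},\mathbb{P})$. ''Decreasing'' means non-increasing. Strong Markov: a real valued process $X$ is strong Markov if for every bounded measurable $g:\mathbb{R}\to\mathbb{R}$ and every $t\in\mathbb{R}_+$ there exists a measurable $f:\mathbb{R}_+\times\mathbb{R}\to\mathbb{R}$ such that $f(\tau,X_\tau)=\mathbb{E}[g(X_{\tau+t})\mid\mathcal{F}_\tau]$ (a.s.) for every finite stopping time $\tau$. Almost-continuous: a real valued process $X$ is almost-continuous if it is cadlag, continuous in probability, and given any two independent, identically distributed cadlag processes $Y,Z$ with the same distribution as $X$, for every $s<t$ in $\mathbb{R}_+$, $$\mathbb{P}\left(Y_s<Z_s,\ Y_t>Z_t \text{ and } Y_u\neq Z_u \text{ for every } u\in(s,t)\right)=0.$$ An almost-continuous diffusion is a process that is both strong Markov and almost-continuous. *)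

(* Defs.v *)
From HB Require Import structures.
From mathcomp Require Import all_boot all_order all_algebra.
From mathcomp Require Import all_classical all_reals all_analysis.

Set Implicit Arguments.
Unset Strict Implicit.
Unset Printing Implicit Defensive.

Import Order.TTheory GRing.Theory Num.Theory.
Import numFieldNormedType.Exports.

Local Open Scope classical_set_scope.
Local Open Scope ring_scope.

(* Time is [0, +oo[, represented inside R: processes, filtrations and functions
   of time are indexed by R, and only their values at nonnegative times are
   ever constrained or used. *)

Section filtered_space.
Context {d : measure_display} {Omega : measurableType d} {R : realType}.
Implicit Types (P : probability Omega R) (G : set (set Omega)).
Implicit Types (F : R -> set (set Omega)) (tau : Omega -> R).

Definition filtration F :=
  [/\ forall t : R, 0 <= t -> sigma_algebra [set: Omega] (F t),
      forall t : R, 0 <= t -> F t `<=` measurable &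
      forall s t : R, 0 <= s -> s <= t -> F s `<=` F t].

Definition measurable_wrt G (Z : Omega -> R) :=
  forall B : set R, measurable B -> G (Z @^-1` B).

Definition condexp_version P G (Y Z : Omega -> R) :=
  [/\ P.-integrable [set: Omega] (EFin \o Y),
      P.-integrable [set: Omega] (EFin \o Z),
      measurable_wrt G Z &
      forall A, G A ->
        (\int[P]_(w in A) (Z w)%:E = \int[P]_(w in A) (Y w)%:E)%E].

(* W = E[Y | G] almost surely; W itself need not be G-measurable, since null
   sets are not assumed to belong to G. *)
Definition as_condexp P G (Y W : Omega -> R) :=
  exists2 Z, condexp_version P G Y Z & {ae P, forall w, W w = Z w}.

Definition finite_stopping_time F tau :=
  (forall w, 0 <= tau w) /\
  (forall t : R, 0 <= t -> F t [set w | tau w <= t]).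

Definition stopped_sigma F tau : set (set Omega) :=
  [set A | measurable A /\
    forall t : R, 0 <= t -> F t (A `&` [set w | tau w <= t])].

Definition martingale P F (X : R -> {RV P >-> R}) :=
  [/\ forall t : R, 0 <= t -> measurable_wrt (F t) (X t),
      forall t : R, 0 <= t -> P.-integrable [set: Omega] (EFin \o X t) &
      forall s t : R, 0 <= s -> s <= t -> as_condexp P (F s) (X t) (X s)].

Definition strong_markov P F (X : R -> {RV P >-> R}) :=
  forall (g : R -> R) (t : R),
    measurable_fun [set: R] g -> bounded_fun g -> 0 <= t ->
    exists f : R -> R -> R,
      measurable_fun ([set u : R | 0 <= u] `*` [set: R])
        (fun p : R * R => f p.1 p.2) /\
      forall tau, finite_stopping_time F tau ->
        as_condexp P (stopped_sigma F tau)
          (fun w => g (X (tau w + t) w))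
          (fun w => f (tau w) (X (tau w) w)).

Definition cadlag P (X : R -> {RV P >-> R}) :=
  forall w,
    (forall t : R, 0 <= t -> X s w @[s --> t^'+] --> X t w) /\
    (forall t : R, 0 < t -> cvg (X s w @[s --> t^'-])).

Definition continuous_in_probability P (X : R -> {RV P >-> R}) :=
  forall t e : R, 0 <= t -> 0 < e ->
    P [set w | e < `|X s w - X t w|]
      @[s --> within [set s : R | 0 <= s] (nbhs t)] --> 0%E.

Definition path_of P (X : R -> {RV P >-> R}) : Omega -> R -> R :=
  fun w t => X t w.

End filtered_space.

(* The product sigma-algebra on paths, generated by the coordinates at
   nonnegative times. *)
Definition path_sigma (R : realType) : set (set (R -> R)) :=
  <<s [set C | exists2 t : R, 0 <= t &
         exists2 B : set R, measurable B & C = [set x | B (x t)]] >>.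

Definition same_distribution (R : realType)
    (d : measure_display) (Omega : measurableType d) (P : probability Omega R)
    (d' : measure_display) (Omega' : measurableType d')
    (P' : probability Omega' R)
    (X : R -> {RV P >-> R}) (Y : R -> {RV P' >-> R}) :=
  forall A, path_sigma A -> P (path_of X @^-1` A) = P' (path_of Y @^-1` A).

Definition independent_processes (R : realType)
    (d : measure_display) (Omega : measurableType d) (P : probability Omega R)
    (Y Z : R -> {RV P >-> R}) :=
  forall A B, path_sigma A -> path_sigma B ->
    (P (path_of Y @^-1` A `&` path_of Z @^-1` B) =
     P (path_of Y @^-1` A) * P (path_of Z @^-1` B))%E.

(* The crossing event quantifies over uncountably many times and need not be
   measurable, so "has probability zero" is read as negligible, i.e. null for
   the completion of P'. *)
Definition almost_continuous (R : realType)
    (d : measure_display) (Omega : measurableType d) (P : probability Omega R)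
    (X : R -> {RV P >-> R}) :=
  [/\ cadlag X,
      continuous_in_probability X &
      forall (d' : measure_display) (Omega' : measurableType d')
        (P' : probability Omega' R) (Y Z : R -> {RV P' >-> R}),
        cadlag Y -> cadlag Z ->
        independent_processes Y Z ->
        same_distribution X Y -> same_distribution X Z ->
        forall s t : R, 0 <= s -> s < t ->
          P'.-negligible [set w | [/\ Y s w < Z s w, Z t w < Y t w &
            forall u : R, s < u -> u < t -> Y u w <> Z u w]]].

Definition almost_continuous_diffusion (R : realType)
    (d : measure_display) (Omega : measurableType d) (P : probability Omega R)
    (F : R -> set (set Omega)) (X : R -> {RV P >-> R}) :=
  strong_markov F X /\ almost_continuous X.

(* Main.v *)
(* Proof idea. Fix [s <= T] and run independent copies of [X] on a product
   space. By almost-continuity two copies cannot exchange their order before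
   they meet, and by the strong Markov property they are exchangeable after
   meeting. With two copies this shows that [E[g(X_T) | X_s = x]] is Lipschitz
   in [x], and with three copies (stopped when the middle one meets one of the
   others) that it is convex, both in the form of inequalities between
   integrals over events of [F s], so that no regular version is needed. The
   first meeting time of cadlag paths need not be a stopping time of a
   filtration that is neither complete nor right-continuous; it is replaced by
   an a.s. equal stopping time, obtained by maximizing an expectation.

   [f s] is the supremum of all convex [k]-Lipschitz [h] such that
   [h (X s) <= E[g(X T) | F s]]. The inequalities above provide enough affine
   minorants for equality to hold, and for [s <= t] Jensen's inequality makes
   [f t] one of the competitors at time [s], whence monotonicity in time for
   every [x], including outside the support of [X s]. *)
Require Import Defs.
From HB Require Import structures.
From mathcomp Require Import all_boot all_order all_algebra.
From mathcomp Require Import all_classical all_reals all_analysis.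
From mathcomp Require Import measurable_realfun ring lra.
Import Order.TTheory GRing.Theory Num.Theory.
Import numFieldNormedType.Exports.
Local Open Scope classical_set_scope.
Local Open Scope ring_scope.
Set Implicit Arguments.
Unset Strict Implicit.
Unset Printing Implicit Defensive.

(** The strong Markov property handles a fixed delay after a stopping time and a single copy,
    whereas the delay from the meeting time to [t1] is random and involves several copies. Stopping
    times on product spaces are therefore only asked to be stopping times for each copy (or pair)
    with the rest frozen, and Fubini's theorem joins the pieces.

    Convexity comes from the determinant of the rows [(1, x, g x)], one row per copy. It changes
    sign when two copies are swapped, so it integrates to zero over the event that two copies have
    met; elsewhere the order of the copies, hence its sign, is preserved. As it is multilinear, its
    integral over a product of three events is again a determinant, now of probabilities, means of
    [X] and means of the payoff; the martingale property replaces the means of [X] at [t1] by those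
    at [s].

    These inequalities are exploited on strips where [X s] lies in an interval of length [e]: a
    [k]-Lipschitz function varies there by at most [k * e], and total errors proportional to [e]
    vanish as [e] tends to 0. *)

Local Notation intble mu f := ((mu).-integrable [set: _] (EFin \o f)).

(** * Integrals of real functions *)

Section real_integrals.
Context d (T : measurableType d) (R : realType).
Variable P : probability T R.
Implicit Types (f g h : T -> R) (A : set T).

Lemma integrable_measurable f : intble P f -> measurable_fun setT f.
Proof. by move=> /measurable_int/measurable_EFinP. Qed.

Lemma integrable_cst (r : R) : intble P (fun=> r).
Proof. exact: finite_measure_integrable_cst. Qed.

Lemma Rintegral_prob_cst (r : R) : \int[P]_w r = r.
Proof.
rewrite Rintegral_cst// -[RHS]mulr1; congr (_ * _).
exact: (congr1 fine (probability_setT P)).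
Qed.

Lemma intbleD f g : intble P f -> intble P g -> intble P (fun w => f w + g w).
Proof. exact: integrableD. Qed.

Lemma intbleB f g : intble P f -> intble P g -> intble P (fun w => f w - g w).
Proof. exact: integrableB. Qed.

Lemma intbleZ (r : R) f : intble P f -> intble P (fun w => r * f w).
Proof. exact: integrableZl. Qed.

Lemma intbleN f : intble P f -> intble P (fun w => - f w).
Proof. exact: integrableN. Qed.

Lemma intble_abs f : intble P f -> intble P (fun w => `|f w|).
Proof. exact: integrable_norm. Qed.

Lemma intble_le f g : measurable_fun setT f -> intble P g ->
  (forall w, `|f w| <= g w) -> intble P f.
Proof.
move=> mf ig fg; apply: le_integrable ig => //; first exact/measurable_EFinP.
by move=> w _ /=; rewrite lee_fin (le_trans (fg w))// ler_norm.
Qed.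

Lemma intble_bounded f (M : R) : measurable_fun setT f ->
  (forall w, `|f w| <= M) -> intble P f.
Proof. by move=> mf fM; apply: (intble_le mf (integrable_cst M)). Qed.

Lemma intbleM_bounded f h (M : R) : measurable_fun setT h ->
  (forall w, `|h w| <= M) -> intble P f -> intble P (fun w => h w * f w).
Proof.
move=> mh hM iF; apply: (@intble_le _ (fun w => M * `|f w|)).
- by apply: measurable_funM => //; exact: integrable_measurable.
- exact/intbleZ/intble_abs.
- by move=> w; rewrite normrM ler_wpM2r.
Qed.

Lemma normr_indic A w : `|\1_A w : R| <= 1.
Proof. by rewrite indicE; case: (w \in A); rewrite ?normr1// normr0. Qed.

Lemma intble_indic A f : measurable A -> intble P f ->
  intble P (fun w => \1_A w * f w).
Proof.
by move=> mA; apply: intbleM_bounded (normr_indic A); exact: measurable_indic.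
Qed.

Lemma Rintegral_indic A f :
  \int[P]_(w in A) f w = \int[P]_w (\1_A w * f w).
Proof.
rewrite Rintegral_mkcond; apply: eq_Rintegral => w _.
by rewrite patchE indicE; case: (w \in A); rewrite ?mul1r ?mul0r.
Qed.

Lemma EFin_Rintegral A f : measurable A -> intble P f ->
  (\int[P]_(w in A) (f w)%:E = (\int[P]_(w in A) f w)%:E)%E.
Proof.
move=> mA iF; rewrite /Rintegral fineK//; apply: integrable_fin_num => //.
exact: integrableS iF.
Qed.

Lemma RintegralN f : intble P f -> \int[P]_w (- f w) = - \int[P]_w f w.
Proof.
move=> iF; rewrite -mulN1r -RintegralZl//.
by apply: eq_Rintegral => w _; rewrite mulN1r.
Qed.

Lemma ae_eq_Rintegral f g : measurable_fun setT f -> measurable_fun setT g ->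
  {ae P, forall w, f w = g w} -> \int[P]_w f w = \int[P]_w g w.
Proof.
move=> mf mg fg; congr fine; apply: ae_eq_integral => //.
- exact/measurable_EFinP.
- exact/measurable_EFinP.
- by apply: filterS fg => w /= -> _.
Qed.

(** Almost everywhere [f] coincides with [min f g], which is below [g] at every point. *)
Lemma ae_le_Rintegral f g : intble P f -> intble P g ->
  {ae P, forall w, f w <= g w} -> \int[P]_w f w <= \int[P]_w g w.
Proof.
move=> iF ig fg.
have mf := integrable_measurable iF; have mg := integrable_measurable ig.
have mm : measurable_fun setT (fun w => Num.min (f w) (g w)).
  exact: measurable_minr.
rewrite (@ae_eq_Rintegral _ (fun w => Num.min (f w) (g w)))//.
  apply: le_Rintegral => //; last by move=> w _; rewrite ge_min lexx orbT.
  apply: (@intble_le _ (fun w => `|f w| + `|g w|)) => //.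
    exact: (intbleD (intble_abs iF) (intble_abs ig)).
  by move=> w; case: (ltP (f w)) => _; rewrite ?lerDl ?lerDr normr_ge0.
by apply: filterS fg => w /min_idPl.
Qed.

Lemma cvg_Rintegral (fn : nat -> T -> R) f g :
  (forall n, measurable_fun setT (fn n)) ->
  (forall w, fn n w @[n --> \oo] --> f w) ->
  intble P g -> (forall n w, `|fn n w| <= g w) ->
  \int[P]_w fn n w @[n --> \oo] --> \int[P]_w f w.
Proof.
move=> mfn fnf ig fng.
have mf : measurable_fun setT f.
  by apply: (measurable_fun_cvg mfn) => w _; exact: fnf.
have fg w : `|f w| <= g w.
  rewrite -(cvg_lim _ (cvg_norm (fnf w)))//; apply: limr_le.
    by apply/cvg_ex; eexists; exact: (cvg_norm (fnf w)).
  by apply: nearW => n; exact: fng.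
have mF h : measurable_fun setT h -> measurable_fun setT (EFin \o h).
  by move=> mh; apply/measurable_EFinP.
have [] := @dominated_convergence _ _ _ P setT measurableT
  (fun n => EFin \o fn n) (EFin \o f) (EFin \o g) (fun n => mF _ (mfn n))
  (mF _ mf).
- by apply: aeW => w _; apply: cvg_EFin; [exact: nearW|exact: fnf].
- exact: ig.
- by apply: aeW => w n _; rewrite lee_fin.
move=> _ _ h.
have /fine_cvg : (\int[P]_w (fn n w)%:E)%E @[n --> \oo] --> (\int[P]_w f w)%:E.
  by rewrite -EFin_Rintegral ?(intble_le _ ig).
exact.
Qed.

Lemma Rintegral_eq0_ae f : intble P f -> (forall w, 0 <= f w) ->
  \int[P]_w f w = 0 -> {ae P, forall w, f w = 0}.
Proof.
move=> iF f0 If0; have mf : measurable_fun setT (EFin \o f) by exact: measurable_int iF.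
have [+ _] := @ae_eq_integral_abs _ _ _ P _ measurableT _ mf.
have -> : (\int[P]_w `|(EFin \o f) w| = 0)%E.
  rewrite -[RHS]/(0%:E) -If0 -EFin_Rintegral//; apply: eq_integral => w _ /=.
  by rewrite ger0_norm.
by move=> /(_ erefl); apply: filterS => w /(_ I)/= [].
Qed.

End real_integrals.

(** * Localization on the level strips of a function *)

Section strips.
Context d (T : measurableType d) (R : realType).
Variable P : probability T R.
Implicit Types (f V : T -> R) (A : set T).

Lemma Rintegral_partition_ge0 (F : nat -> set T) f :
  (forall n, measurable (F n)) -> trivIset setT F -> \bigcup_n F n = setT ->
  intble P f -> (forall n, 0 <= \int[P]_(w in F n) f w) -> 0 <= \int[P]_w f w.
Proof.
move=> mF tF FT iF F0; rewrite -lee_fin -EFin_Rintegral// -FT.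
rewrite integral_bigcup//; last by rewrite FT.
by apply: nneseries_ge0 => n _ _; rewrite EFin_Rintegral// lee_fin.
Qed.

(** For [e > 0] these cells partition the space and are observable from [V], and on each of them [V]
    is known up to [e]. They stand in for conditioning on the value of [V]. *)
Definition strip V (e : R) (z : int) : set T :=
  [set w | z%:~R * e <= V w < (z + 1)%:~R * e].

Lemma strip_measurable V e z : measurable_fun setT V -> measurable (strip V e z).
Proof.
move=> mV; rewrite (_ : strip _ _ _ = V @^-1` `[z%:~R * e, (z + 1)%:~R * e[%classic).
  by rewrite -[X in measurable X]setTI; exact: mV.
by apply/seteqP; split => w /=; rewrite in_itv.
Qed.

Lemma Rintegral_strip_ge0 V (e : R) f : 0 < e -> measurable_fun setT V ->
  intble P f -> (forall z, 0 <= \int[P]_(w in strip V e z) f w) ->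
  0 <= \int[P]_w f w.
Proof.
move=> e0 mV iF f0.
have stripP w z : strip V e z w -> z = Num.floor (V w / e).
  move=> /andP[zV Vz]; apply/esym/floor_def.
  by rewrite ler_pdivlMr// zV ltr_pdivrMr.
(* The strips are enumerated by [nat] through the encoding of [int]; numbers that encode nothing
   give the empty set. *)
pose F n := if @pickle_inv int n is Some z then strip V e z else set0.
apply: (@Rintegral_partition_ge0 F) => //.
- by move=> n; rewrite /F; case: pickle_inv => // z; exact: strip_measurable.
- move=> m n _ _ [w []]; rewrite /F.
  have := @pickle_invK int m; have := @pickle_invK int n.
  case: (pickle_inv m) => //= y; case: (pickle_inv n) => //= z <- <-.
  by move=> /stripP -> /stripP ->.
- rewrite -subTset => w _; exists (pickle (Num.floor (V w / e))); first exact: I.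
  rewrite /F pickleK_inv.
  have /andP[] := floor_itv (V w / e).
  by rewrite /strip /mkset ler_pdivlMr// ltr_pdivrMr// => -> ->.
- by move=> n; rewrite /F; case: pickle_inv => [z//|]; rewrite Rintegral_set0.
Qed.

(** On a strip of [V] the factor [V] is almost a constant, and [D] integrates to 0 there because the
    strip is in [G]. The error is at most the width times the integral of [|D|]. One inequality
    suffices, as it also applies to [- V]. *)
Lemma pull_out (G : set (set T)) D V (M : R) :
  sigma_algebra setT G -> G `<=` measurable ->
  intble P D -> (forall A, G A -> \int[P]_(w in A) D w = 0) ->
  measurable_wrt G V -> (forall w, `|V w| <= M) ->
  \int[P]_w (V w * D w) = 0.
Proof.
move=> sG Gm iD D0.
have half U (N : R) : measurable_wrt G U -> (forall w, `|U w| <= N) ->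
    0 <= \int[P]_w (U w * D w).
  move=> GU UM.
  have mU : measurable_fun setT U by move=> _ B mB; rewrite setTI; exact/Gm/GU.
  have iUD : intble P (fun w => U w * D w) by exact: intbleM_bounded UM iD.
  apply/ler_addgt0Pr => e e0.
  (* Strips of width [e / c] give a total error of [e / c] times the integral of [|D|], at most [e];
     the summand 1 keeps [c] positive. *)
  pose c := `|\int[P]_w `|D w| | + 1.
  have c0 : 0 < c by rewrite ltr_wpDl.
  have ec0 : 0 < e / c by rewrite divr_gt0.
  have iaD := intble_abs iD.
  have : 0 <= \int[P]_w (U w * D w + (e / c) * `|D w|).
    apply: (Rintegral_strip_ge0 ec0 mU); first exact/intbleD/intbleZ.
    move=> z; set A := strip _ _ _.
    have mA : measurable A by exact: strip_measurable.
    have GA : G A.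
      rewrite (_ : A = U @^-1` `[z%:~R * (e / c), (z + 1)%:~R * (e / c)[%classic).
        exact: GU.
      by apply/seteqP; split => w /=; rewrite in_itv.
    (* Since the strip is in [G], subtracting the constant level [z%:~R * (e / c)] times [D] does
       not change the integral, and the new integrand is nonnegative. *)
    suff -> : \int[P]_(w in A) (U w * D w + (e / c) * `|D w|) =
        \int[P]_(w in A) (U w * D w + (e / c) * `|D w| - z%:~R * (e / c) * D w).
      apply: Rintegral_ge0 => w; rewrite /A /strip /=.
      set x := z%:~R * (e / c); rewrite intrD mulrDl -/x mul1r => /andP[xU Ux].
      have : `|(U w - x) * D w| <= (e / c) * `|D w|.
        by rewrite normrM ler_wpM2r// ger0_norm ?subr_ge0//; lra.
      by rewrite ler_norml => /andP[]; lra.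
    have iA h : intble P h -> P.-integrable A (EFin \o h) by exact: integrableS.
    rewrite RintegralB// ?RintegralZl ?D0 ?mulr0 ?subr0//; apply: iA => //.
      exact/intbleD/intbleZ.
    exact: intbleZ.
  rewrite RintegralD//; last exact: intbleZ.
  rewrite RintegralZl// => h; apply: le_trans h _; rewrite lerD2l.
  rewrite mulrAC ler_pdivrMr// ler_pM2l// /c.
  by rewrite (le_trans (ler_norm _))// lerDl.
move=> GV VM; apply/eqP; rewrite eq_le (half _ M)// andbT.
have mV : measurable_fun setT V by move=> _ B mB; rewrite setTI; exact/Gm/GV.
rewrite -oppr_ge0 -RintegralN; last exact: intbleM_bounded VM iD.
under eq_Rintegral do rewrite -mulNr.
apply: (half _ M); last by move=> w; rewrite normrN.
move=> B mB; have := GV (-%R @^-1` B); rewrite /preimage/=; apply.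
by rewrite -[X in measurable X]setTI; exact: oppr_measurable.
Qed.

End strips.

(** * Stopping times and right-continuous processes *)

Section sub_sigma_algebras.
Context d (T : measurableType d) (R : realType).
Variable G : set (set T).
Hypothesis sG : sigma_algebra setT G.
Implicit Types (A B : set T) (F : nat -> set T).

(** Views [G] as the measurable sets of a type, so that general measurability results apply to
    sub-sigma-algebras. *)
Let GE A : G A = measurable (A : set (g_sigma_algebraType G)).
Proof. by rewrite -[in LHS](measurable_g_measurableTypeE sG). Qed.

Lemma salg0 : G set0. Proof. by case: sG. Qed.
Lemma salgT : G setT. Proof. by rewrite GE. Qed.
Lemma salgC A : G A -> G (~` A). Proof. by rewrite !GE; exact: measurableC. Qed.
Lemma salgI A B : G A -> G B -> G (A `&` B).
Proof. by rewrite !GE; exact: measurableI. Qed.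
Lemma salgU A B : G A -> G B -> G (A `|` B).
Proof. by rewrite !GE; exact: measurableU. Qed.
Lemma salgD A B : G A -> G B -> G (A `\` B).
Proof. by rewrite !GE; exact: measurableD. Qed.
Lemma salg_bigcup F : (forall n, G (F n)) -> G (\bigcup_n F n).
Proof. by case: sG => _ _; exact. Qed.
Lemma salg_bigcup_rat (F : rat -> set T) :
  (forall q, G (F q)) -> G (\bigcup_q F q).
Proof.
by move=> GF; rewrite GE; apply: bigcupT_measurable_rat => q; rewrite -GE.
Qed.
Lemma salg_bigcap F : (forall n, G (F n)) -> G (\bigcap_n F n).
Proof.
by move=> GF; rewrite GE; apply: bigcapT_measurable => n; rewrite -GE.
Qed.

Lemma measurable_wrtE (Z : T -> R) :
  measurable_wrt G Z <-> measurable_fun setT (Z : g_sigma_algebraType G -> R).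
Proof.
split=> [GZ _ B mB|mZ B mB].
  by rewrite setTI -GE; exact: GZ.
by rewrite GE -[X in measurable X]setTI; exact: mZ.
Qed.

Lemma measurable_wrt_sublevel (Z : T -> R) :
  (forall r, G [set w | Z w <= r]) -> measurable_wrt G Z.
Proof.
move=> GZ; apply/measurable_wrtE.
apply: (measurability _ (RGenOInfty.measurableE R)) => //= _ [_ [r ->] <-].
rewrite setTI -GE; set S := (X in G X).
suff -> : S = ~` [set w | Z w <= r] by exact/salgC.
by apply/seteqP; split => w; rewrite /S /= in_itv/= andbT ltNge => /negP.
Qed.

End sub_sigma_algebras.

Section processes.
Context d (T : measurableType d) (R : realType).
Implicit Types (W : R -> T -> R) (tau : T -> R) (H : R -> set (set T)).

Definition right_continuous W :=
  forall w (t : R), 0 <= t -> W s w @[s --> t^'+] --> W t w.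

(** [tau] is approximated by the next multiple [q n] of [1 / n.+1], always strictly larger, so that
    right continuity applies; at a time with countably many values measurability is clear. *)
Lemma measurable_process_at W tau :
  (forall t, 0 <= t -> measurable_fun setT (W t)) -> right_continuous W ->
  measurable_fun setT tau -> (forall w, 0 <= tau w) ->
  measurable_fun setT (fun w => W (tau w) w).
Proof.
move=> mW cW mtau tau0.
pose q (n : nat) w : R := (Num.truncn (tau w * n.+1%:R)).+1%:R / n.+1%:R.
have q_gt n w : tau w < q n w.
  by rewrite /q ltr_pdivlMr ?ltr0n// truncnS_gt.
have q_le n w : q n w <= tau w + n.+1%:R^-1.
  rewrite /q ler_pdivrMr ?ltr0n// mulrDl mulVf ?pnatr_eq0// -natr1 lerD2r.
  by rewrite truncn_le mulr_ge0.
apply: (@measurable_fun_cvg _ _ _ _ (fun n w => W (q n w) w)); last first.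
  move=> w _; have /cvg_at_rightP := cW w _ (tau0 w).
  apply; split => [n|]; first exact: q_gt.
  apply: (@squeeze_cvgr _ _ _ _ (cst (tau w)) (fun n => tau w + n.+1%:R^-1)).
  - by apply: nearW => n; rewrite ltW//= q_le.
  - exact: cvg_cst.
  - rewrite -[X in _ --> X]addr0; apply: cvgD; first exact: cvg_cst.
    exact: cvg_harmonic.
move=> n _ B mB; rewrite setTI.
rewrite (_ : _ @^-1` _ = \bigcup_(k : nat)
  ((fun w => tau w * n.+1%:R) @^-1` `[k%:R, k.+1%:R[%classic `&`
   W (k.+1%:R / n.+1%:R) @^-1` B)).
  apply: bigcupT_measurable => k; apply: measurableI.
    by rewrite -[X in measurable X]setTI; apply: measurable_funM.
  by rewrite -[X in measurable X]setTI; apply: mW => //; rewrite divr_ge0.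
have tn w : 0 <= tau w * n.+1%:R by rewrite mulr_ge0.
apply/seteqP; split => w.
  move=> BW; exists (Num.truncn (tau w * n.+1%:R)); first exact: I.
  by split => //=; rewrite in_itv; exact: truncn_itv.
move=> [k _ [/=]]; rewrite in_itv => /= /truncn_def kE; by rewrite /q kE.
Qed.

End processes.

Section filtered.
Context d (T : measurableType d) (R : realType).
Implicit Types (W : R -> T -> R).
Variable H : R -> set (set T).
Hypothesis fH : filtration H.

Let sH t : 0 <= t -> sigma_algebra setT (H t).
Proof. by case: fH => + _ _; exact. Qed.

Lemma filtration_le s t A : 0 <= s -> s <= t -> H s A -> H t A.
Proof. by move=> s0 st; case: fH => _ _ /(_ _ _ s0 st); exact. Qed.

Lemma filtration_measurable t A : 0 <= t -> H t A -> measurable A.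
Proof. by move=> t0; case: fH => _ /(_ _ t0) + _; exact. Qed.

Lemma measurable_wrt_measurable t (Z : T -> R) : 0 <= t ->
  measurable_wrt (H t) Z -> measurable_fun setT Z.
Proof.
by move=> t0 HZ _ B mB; rewrite setTI; exact/(filtration_measurable t0)/HZ.
Qed.

Lemma measurable_wrt_le s t (Z : T -> R) : 0 <= s -> s <= t ->
  measurable_wrt (H s) Z -> measurable_wrt (H t) Z.
Proof. by move=> s0 st HZ B mB; exact/(filtration_le s0 st)/HZ. Qed.

Section at_stopping_time.
Variable tau : T -> R.
Hypothesis stau : finite_stopping_time H tau.

Lemma stopping_time_le t r : 0 <= t -> r <= t -> H t [set w | tau w <= r].
Proof.
move=> t0 rt; have [r0|r0] := leP 0 r.
  by apply: (filtration_le r0 rt); case: stau => _; exact.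
rewrite (_ : [set w | _] = set0); first exact: (salg0 (sH t0)).
rewrite -subset0 => w /= tr; case: stau => /(_ w) t0' _.
by move: (le_lt_trans (le_trans t0' tr) r0); rewrite ltxx.
Qed.

Lemma stopping_time_measurable : measurable_fun setT tau.
Proof.
move=> _ B mB; rewrite setTI.
have : measurable_wrt (@measurable d T) tau; last by apply.
apply: measurable_wrt_sublevel; first exact: sigma_algebra_measurable.
move=> r; have [r0|r0] := leP 0 r.
  exact: (filtration_measurable r0 (stopping_time_le _ _)).
apply: (filtration_measurable (lexx 0)).
exact: (stopping_time_le (lexx 0) (ltW r0)).
Qed.

Lemma stopped_sigma_algebra : sigma_algebra setT (stopped_sigma H tau).
Proof.
split.
- by split => // t t0; rewrite set0I; exact: (salg0 (sH t0)).
- move=> A [mA HA]; rewrite setTD; split; first exact: measurableC.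
  move=> t t0; rewrite (_ : _ `&` _ =
      [set w | tau w <= t] `\` (A `&` [set w | tau w <= t])).
    by apply: (salgD (sH t0)); [exact: stopping_time_le|exact: HA].
  apply/seteqP; split => w /= [h1 h2]; split => //; first by case.
  by move=> Aw; exact: h2.
- move=> A HA; split; first by apply: bigcupT_measurable => n; case: (HA n).
  move=> t t0; rewrite setI_bigcupl; apply: (salg_bigcup (sH t0)) => n.
  by case: (HA n) => _; exact.
Qed.

Lemma stopped_sigma_measurable : stopped_sigma H tau `<=` measurable.
Proof. by move=> A []. Qed.

Lemma stopping_time_stopped : measurable_wrt (stopped_sigma H tau) tau.
Proof.
apply: measurable_wrt_sublevel; first exact: stopped_sigma_algebra.
move=> r; split.
  rewrite -[X in measurable X]setTI.
  by apply: (measurable_fun_ler (g := cst r)) => //; exact: stopping_time_measurable.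
move=> t t0; rewrite (_ : _ `&` _ = [set w | tau w <= Num.min r t]).
  by apply: stopping_time_le => //; rewrite ge_min lexx orbT.
by apply/seteqP; split => w /=; rewrite le_min => /andP.
Qed.

(** On [tau <= t] the value at [tau] is that of the process stopped at [t], and
    [measurable_process_at] applies to the latter on the space equipped with [H t]. *)
Lemma stopped_process W : (forall t, 0 <= t -> measurable_wrt (H t) (W t)) ->
  right_continuous W ->
  measurable_wrt (stopped_sigma H tau) (fun w => W (tau w) w).
Proof.
move=> HW cW B mB; split.
  rewrite -[X in measurable X]setTI; apply: measurable_process_at => //.
  - by move=> t t0; exact: measurable_wrt_measurable (HW _ t0).
  - exact: stopping_time_measurable.
  - by case: stau.
move=> t t0.
have mH r : 0 <= r -> measurable_wrt (H t) (W (Num.min r t)).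
  move=> r0; apply: (@measurable_wrt_le (Num.min r t)); first by rewrite le_min r0.
    by rewrite ge_min lexx orbT.
  by apply: HW; rewrite le_min r0.
(* The inner minimum truncates the time, the outer one belongs to the stopped process. *)
have : measurable_wrt (H t) (fun w => W (Num.min (Num.min (tau w) t) t) w).
  apply/(measurable_wrtE (sH t0)).
  apply: (@measurable_process_at _ (g_sigma_algebraType (H t)) R
    (fun r => W (Num.min r t)) (fun w => Num.min (tau w) t)).
  - by move=> r r0; apply/(measurable_wrtE (sH t0)); exact: mH.
  - move=> w r r0; apply/cvg_at_rightP => u [ur ucvg] /=.
    have [rt|tr] := ltP r t; last first.
      under eq_fun do rewrite (min_idPr (le_trans tr (ltW (ur _)))).
      exact: cvg_cst.
    have /cvg_at_rightP := cW w r r0 => /(_ u (conj ur ucvg)).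
    apply: cvg_trans; apply: near_eq_cvg.
    have : \forall n \near \oo, u n < t by apply: cvgr_lt rt.
    by apply: filterS => n /ltW/min_idPl ->.
  - apply/(measurable_wrtE (sH t0)); apply: measurable_wrt_sublevel; first exact: sH.
    move=> r; have [tr|rt] := leP t r.
      rewrite (_ : [set w | _] = setT); first exact: (salgT (sH t0)).
      by apply/seteqP; split => // w _ /=; rewrite ge_min tr orbT.
    rewrite (_ : [set w | _] = [set w | tau w <= r]).
      exact: stopping_time_le (ltW rt).
    by apply/seteqP; split => w /=; rewrite ge_min (leNgt t) rt orbF.
  - by move=> w; rewrite le_min t0 andbT; case: stau.
move=> /(_ B mB) HB; rewrite (_ : _ `&` _ =
  (fun w => W (Num.min (Num.min (tau w) t) t) w) @^-1` B `&` [set w | tau w <= t]).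
  by apply: (salgI (sH t0)) => //; exact: stopping_time_le.
apply/seteqP; split => w [/= h1 h2]; split => //=; move: h1;
  by rewrite (min_idPl h2) (min_idPl h2).
Qed.

End at_stopping_time.
End filtered.

Lemma at_rightW (R : realType) (t : R) (Q : R -> Prop) : (\forall u \near t^'+, Q u) ->
  exists2 e, 0 < e & forall u, t < u -> u < t + e -> Q u.
Proof.
move=> /nbhs_ballP[e /= e0 be]; exists e => // u tu ue; apply: be => //.
by rewrite /ball/= ltr_distlC; apply/andP; split => //; lra.
Qed.

(** * First zeros of an adapted right-continuous process *)

Section hitting.
Context d (T : measurableType d) (R : realType).
Variables (P : probability T R) (H : R -> set (set T)) (W : R -> T -> R).
Hypothesis fH : filtration H.
Hypothesis aW : forall t, 0 <= t -> measurable_wrt (H t) (W t).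
Hypothesis cW : right_continuous W.
Variables (s t1 : R).
Hypotheses (s0 : 0 <= s) (st1 : s <= t1).
Implicit Types (w : T) (sigma tau : T -> R).

Let t10 : 0 <= t1. Proof. exact: le_trans s0 st1. Qed.

Lemma right_continuous_lt w t c : 0 <= t -> `|W t w| < c ->
  exists2 e, 0 < e & forall u, t <= u -> u < t + e -> `|W u w| < c.
Proof.
move=> t0 Wc; have /cvgr_norm_lt/(_ _ Wc)/at_rightW[e e0 he] := @cW w t t0.
by exists e => // u; rewrite le_eqVlt => /predU1P[<-//|]; exact: he.
Qed.

Lemma right_continuous_gt w t c : 0 <= t -> c < `|W t w| ->
  exists2 e, 0 < e & forall u, t <= u -> u < t + e -> c < `|W u w|.
Proof.
move=> t0 Wc; have /cvgr_norm_gt/(_ _ Wc)/at_rightW[e e0 he] := @cW w t t0.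
by exists e => // u; rewrite le_eqVlt => /predU1P[<-//|]; exact: he.
Qed.

(** The class over which the expectation is maximized. The inequality [u < tau w] is strict: a zero
    at [tau w] itself is allowed, and is the desired outcome. This also makes the class stable under
    countable suprema. *)
Definition zero_free_until tau := [/\ finite_stopping_time H tau,
  forall w, s <= tau w <= t1 &
  forall w u, s <= u -> u < tau w -> W u w != 0].

Section next.
Variable sigma : T -> R.
Hypothesis ssigma : zero_free_until sigma.

(* [nears t w]: the infimum of [|W|] over [[sigma w, t]] is [0]; by right
   continuity it may be computed over rational times and [t] itself. *)
Let nears t w := forall n : nat, exists q : R,
  [/\ sigma w <= q, q <= t, `|W q w| < n.+1%:R^-1 &
      (exists r : rat, q = ratr r) \/ q = t].

Let sigma0 w : 0 <= sigma w.
Proof. by case: ssigma => -[+ _] _ _; exact. Qed.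

(** A witness equal to the endpoint [t] is not an endpoint for [t']; right continuity moves it to a
    slightly larger rational. *)
Let nears_mono t t' w : t <= t' -> nears t w -> nears t' w.
Proof.
rewrite le_eqVlt => /predU1P[<-//|tt'] Zt n.
have [q [sq qt Wq [[r qr]|qt']]] := Zt n.
  by exists q; split => //; [exact: le_trans qt (ltW tt')|left; exists r].
have q0 := le_trans (sigma0 w) sq.
have [e e0 he] := right_continuous_lt q0 Wq.
have : q < Num.min (q + e) t' by rewrite lt_min ltrDl e0 qt'.
move=> /rat_in_itvoo[r]; rewrite in_itv/= lt_min => /and3P[qr re rt'].
exists (ratr r); split; [exact: le_trans sq (ltW qr)|exact: ltW| |by left; exists r].
by apply: he => //; exact: ltW.
Qed.

(** Including [t1] keeps the set nonempty and caps its infimum at [t1]. *)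
Let S w := [set t | t = t1 \/ (t <= t1 /\ nears t w)].

Let S_lb w : lbound (S w) (sigma w).
Proof.
move=> t [->|[_ /(_ 0%N)[q [sq qt _ _]]]]; last exact: le_trans sq qt.
by case: ssigma => _ /(_ w)/andP[].
Qed.

Let S_inf w : has_inf (S w).
Proof. by split; [exists t1; left|exists (sigma w); exact: S_lb]. Qed.

Let tau w := inf (S w).

Let tau_le w : tau w <= t1.
Proof. by apply: ge_inf; [case: (S_inf w)|left]. Qed.

Let tau_ge w : sigma w <= tau w.
Proof. by apply: lb_le_inf; [case: (S_inf w)|exact: S_lb]. Qed.

(** If [|W|] stayed away from 0 up to the infimum, right continuity would keep it away from 0 a
    little longer, and the infimum would be larger. *)
Let tau_attained w : tau w < t1 -> nears (tau w) w.
Proof.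
move=> taut1; apply: contrapT => /existsNP[n nn].
have tau0 := le_trans (sigma0 w) (tau_ge w).
(* Passing from [n.+1] to [n.+2] provides the strict inequality that right continuity propagates. *)
have Wt : n.+2%:R^-1 < `|W (tau w) w|.
  rewrite (@lt_le_trans _ _ n.+1%:R^-1)//.
    by rewrite ltf_pV2 ?posrE ?ltr0n// ltr_nat.
  by rewrite leNgt; apply/negP => Wn; apply: nn; exists (tau w); split => //; right.
have [e e0 he] := right_continuous_gt tau0 Wt.
have : inf (S w) < Num.min (tau w + e) t1 by rewrite lt_min ltrDl e0 taut1.
move=> /inf_lt[|t St]; first by case: (S_inf w).
have taut : tau w <= t by apply: ge_inf => //; case: (S_inf w).
rewrite lt_min => /andP[te tt1].
case: St => [tE|[_ Zt]]; first by rewrite tE ltxx in tt1.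
have [q [sq qt Wq qr]] := Zt n.+1.
have [tauq|qtau] := leP (tau w) q.
  by have := he q tauq (le_lt_trans qt te); rewrite ltNge (ltW Wq).
apply: nn; exists q; split => //; first exact: ltW.
  by rewrite (lt_trans Wq)// ltf_pV2 ?posrE ?ltr0n// ltr_nat.
left; case: qr => // qE; move: (lt_le_trans qtau taut).
by rewrite qE ltxx.
Qed.

Let tau_leE t : t < t1 -> [set w | tau w <= t] = [set w | nears t w].
Proof.
move=> tt1; apply/seteqP; split => w /=.
  move=> taut; apply: (nears_mono taut); apply: tau_attained.
  exact: le_lt_trans taut tt1.
by move=> Zt; apply: ge_inf; [case: (S_inf w)|right; rewrite ltW].
Qed.

Let H_small t q (c : R) : 0 <= q -> q <= t ->
  H t [set w | sigma w <= q /\ `|W q w| < c].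
Proof.
move=> q0 qt; apply: (filtration_le fH q0 qt).
have [sH _ _] := fH; apply: (salgI (sH _ q0)).
  by case: ssigma => -[_ +] _ _; exact.
have := aW q0 => /(_ `]- c, c[%classic (measurable_itv _)).
rewrite (_ : _ @^-1` _ = [set w | `|W q w| < c])//.
by apply/seteqP; split => w /=; rewrite in_itv/= ltr_norml.
Qed.

(** The time built is the first one, capped at [t1], at which the infimum of [|W|] since [sigma] is
    0. [W] need not vanish there, as it may only approach 0 from the left; but from such a time one
    can restart and move strictly forward, by right continuity. Working with infima over rational
    times makes it a stopping time without completing the filtration. *)
Lemma next_zero_free : exists tau', [/\ zero_free_until tau',
  forall w, sigma w <= tau' w &
  forall w, W (sigma w) w != 0 -> sigma w < t1 -> sigma w < tau' w].
Proof.
have [sH _ _] := fH; have [ss s_le s_zf] := ssigma.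
exists tau; split => //.
- split.
  + split=> [w|t t0]; first exact: le_trans (sigma0 w) (tau_ge w).
    have [t1t|tt1] := leP t1 t.
      rewrite (_ : [set w | _] = setT); first exact: (salgT (sH _ t0)).
      by apply/seteqP; split => // w _; exact: le_trans (tau_le w) t1t.
    rewrite tau_leE//.
    (* [A q n] is observable at time [q] because [sigma] is a stopping time; this writes [nears t]
       as a countable combination of events of [H t]. *)
    pose A q n : set T := [set w | sigma w <= q /\ `|W q w| < n.+1%:R^-1].
    pose B n : set T := A t n `|`
      \bigcup_(r : rat) (if 0 <= (ratr r : R) <= t then A (ratr r) n else set0).
    have -> : [set w | nears t w] = \bigcap_n B n; last first.
      apply: (salg_bigcap (sH _ t0)) => n; apply: (salgU (sH _ t0)).
        exact: H_small.
      apply: (salg_bigcup_rat (sH _ t0)) => r.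
      case: ifP => [/andP[r0 rt]|_]; first exact: H_small.
      exact: (salg0 (sH _ t0)).
    apply/seteqP; split => w /=.
      move=> Zt n _; have [q [sq qt Wq [[r qE]|qE]]] := Zt n.
        right; exists r => //; rewrite -qE qt (le_trans (sigma0 w) sq)/=.
        by [].
      by left; rewrite -qE.
    move=> Zt n; case: (Zt n I) => [[st Wt]|[r _]].
      by exists t; split => //; right.
    case: ifP => // /andP[r0 rt] [/= sr Wr].
    by exists (ratr r); split => //; left; exists r.
  + by move=> w; rewrite tau_le (le_trans _ (tau_ge w))//; case/andP: (s_le w).
  + move=> w u su ut; have [us|su'] := ltP u (sigma w); first exact: s_zf.
    apply/negP => /eqP Wu0; move: ut; apply/negP; rewrite -leNgt.
    have [t1u|ut1] := leP t1 u; first exact: le_trans (tau_le w) t1u.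
    apply: ge_inf; [by case: (S_inf w)|right; split; first exact: ltW].
    move=> n; exists u; split => //; last by right.
    by rewrite Wu0 normr0 invr_gt0 ltr0n.
- move=> w W0 st; rewrite lt_neqAle tau_ge andbT; apply/negP => /eqP stau.
  have := @tau_attained w; rewrite -stau => /(_ st) Zs.
  have := normr_gt0 (W (sigma w) w); rewrite W0 => /ltr_add_invr[n].
  rewrite add0r => nW; have [q [sq qs Wq _]] := Zs n.
  have qE : q = sigma w by apply/eqP; rewrite eq_le sq qs.
  by move: Wq; rewrite qE => /(lt_trans nW); rewrite ltxx.
Qed.

End next.

Let zero_free_s : zero_free_until (fun=> s).
Proof.
split; [split => [_ //|t t0]|move=> w|move=> w u su]; last 2 first.
- by rewrite lexx.
- by move=> /(le_lt_trans su); rewrite ltxx.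
have [sH _ _] := fH; have [st|ts] := leP s t.
  by rewrite (_ : [set w | _] = setT); [exact: (salgT (sH _ t0))|exact/seteqP].
rewrite (_ : [set w | _] = set0); first exact: (salg0 (sH _ t0)).
by rewrite -subset0.
Qed.

Let zero_free_intble tau : zero_free_until tau -> intble P tau.
Proof.
move=> [stau tau1 _]; apply: (@intble_bounded _ _ _ _ _ t1).
  exact: stopping_time_measurable stau.
move=> w; have /andP[stw twt] := tau1 w.
by rewrite ger0_norm// (le_trans s0).
Qed.

(** A supremum is at most [t] when all terms are, so it is a stopping time for any filtration; a
    time before the supremum is before one of the terms. *)
Let zero_free_sup (taun : nat -> T -> R) :
  (forall n, zero_free_until (taun n)) ->
  exists tau, zero_free_until tau /\ forall n w, taun n w <= tau w.
Proof.
move=> zn; pose S w := [set taun n w | n in [set: nat]].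
have Sne w : S w !=set0 by exists (taun 0%N w); exists 0%N.
have Sub w : ubound (S w) t1.
  by move=> _ [n _ <-]; case: (zn n) => _ /(_ w)/andP[].
have Sle n w : taun n w <= sup (S w).
  by apply: ub_le_sup; [exists t1; exact: Sub|exists n].
have [sH _ _] := fH.
exists (fun w => sup (S w)); split => //; split.
- split=> [w|t t0].
    by apply: le_trans (Sle 0%N w); case: (zn 0%N) => -[].
  rewrite (_ : [set w | _] = \bigcap_n [set w | taun n w <= t]).
    by apply: (salg_bigcap (sH _ t0)) => n; case: (zn n) => -[_ +] _ _; exact.
  apply/seteqP; split => w /=; first by move=> St n _; exact: le_trans (Sle n w) St.
  by move=> tt; apply: ge_sup => // _ [n _ <-]; exact: tt.
- move=> w; rewrite (ge_sup (Sne w) (@Sub w)) andbT (le_trans _ (Sle 0%N w))//.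
  by case: (zn 0%N) => _ /(_ w)/andP[].
- move=> w u su /(sup_gt (Sne w))[_ [n _ <-]].
  by case: (zn n) => _ _; exact.
Qed.

(* Among the times before which [W] does not vanish, one of maximal
   expectation is a.s. either [t1] or a zero of [W]: otherwise
   [next_zero_free] would increase it. *)
Lemma first_zero : exists tau, zero_free_until tau /\
  {ae P, forall w, W (tau w) w = 0 \/ tau w = t1}.
Proof.
pose E := [set \int[P]_w tau w | tau in zero_free_until].
have Ene : E !=set0 by exists (\int[P]_w s); exists (fun=> s).
have Eub : ubound E t1.
  move=> _ [tau ztau <-].
  rewrite (@le_trans _ _ (\int[P]_w t1))//.
    apply: le_Rintegral => //; [exact: zero_free_intble|exact: integrable_cst|].
    by move=> w _; case: ztau => _ /(_ w)/andP[].
  by rewrite Rintegral_prob_cst.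
have hE : has_sup E by split => //; exists t1.
have /choice[taun taunP] : forall n, exists tau,
    zero_free_until tau /\ sup E - n.+1%:R^-1 < \int[P]_w tau w.
  move=> n; have n0 : 0 < n.+1%:R^-1 :> R by rewrite invr_gt0 ltr0n.
  by have [_ [tau ztau <-] ltE] := sup_adherent n0 hE; exists tau.
have [sigma [zsigma sigmaP]] := zero_free_sup (fun n => (taunP n).1).
have [tau [ztau st tgt]] := next_zero_free zsigma.
have isigma := zero_free_intble zsigma; have itau := zero_free_intble ztau.
exists sigma; split => //.
have supE : sup E <= \int[P]_w sigma w.
  rewrite leNgt; apply/negP => /ltr_add_invr[n]; apply/negP; rewrite -leNgt.
  rewrite -lerBlDr; apply: le_trans (ltW (taunP n).2) _.
  by apply: le_Rintegral => //; exact/zero_free_intble/(taunP n).1.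
have tauE : \int[P]_w tau w <= sup E by apply: ub_le_sup; [exists t1|exists tau].
(* [sigma] already has the maximal expectation and [sigma <= tau], so the two agree almost surely;
   strict progress is then impossible. *)
have d0 : \int[P]_w (tau w - sigma w) = 0.
  apply/eqP; rewrite eq_le Rintegral_ge0; last by move=> w _; rewrite subr_ge0.
  by rewrite andbT RintegralB// subr_le0 (le_trans tauE).
have iB := intbleB itau isigma.
have d_ge0 w : 0 <= tau w - sigma w by rewrite subr_ge0.
have := Rintegral_eq0_ae iB d_ge0 d0; apply: filterS => w /eqP.
rewrite subr_eq0 => /eqP tsE.
have [W0|W0] := eqVneq (W (sigma w) w) 0; first by left.
right; apply/eqP; rewrite eq_le; case: (zsigma) => _ /(_ w)/andP[_ ->] _ /=.
by rewrite leNgt; apply/negP => /(tgt _ W0); rewrite tsE ltxx.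
Qed.

End hitting.

(** * Product spaces and the strong Markov property *)

Section products.
Context d1 d2 (T1 : measurableType d1) (T2 : measurableType d2) (R : realType).
Variables (P : probability T1 R) (Q : probability T2 R).

Definition prob_prod : probability (T1 * T2)%type R := (P \x Q)%E.

Implicit Types F G : T1 * T2 -> R.

Lemma fubini_eq1 F G : intble prob_prod F -> intble prob_prod G ->
  (forall x, [/\ intble Q (fun y => F (x, y)), intble Q (fun y => G (x, y)) &
    \int[Q]_y F (x, y) = \int[Q]_y G (x, y)]) ->
  \int[prob_prod]_z F z = \int[prob_prod]_z G z.
Proof.
move=> iF iG FG; congr fine.
rewrite -(@integral12_prod_meas1 _ _ _ _ _ P Q _ iF).
rewrite -(@integral12_prod_meas1 _ _ _ _ _ P Q _ iG).
apply: eq_integral => x _; have [iFx iGx FGx] := FG x.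
by rewrite /fubini_F !EFin_Rintegral// FGx.
Qed.

Lemma fubini_eq2 F G : intble prob_prod F -> intble prob_prod G ->
  (forall y, [/\ intble P (fun x => F (x, y)), intble P (fun x => G (x, y)) &
    \int[P]_x F (x, y) = \int[P]_x G (x, y)]) ->
  \int[prob_prod]_z F z = \int[prob_prod]_z G z.
Proof.
move=> iF iG FG; congr fine.
rewrite -(@integral21_prod_meas1 _ _ _ _ _ P Q _ iF).
rewrite -(@integral21_prod_meas1 _ _ _ _ _ P Q _ iG).
apply: eq_integral => y _; have [iFy iGy FGy] := FG y.
by rewrite /fubini_G !EFin_Rintegral// FGy.
Qed.

Lemma intble_prod f g : intble P f -> intble Q g ->
  intble prob_prod (fun z => f z.1 * g z.2).
Proof.
move=> iF ig.
have mfg : measurable_fun setT (fun z : T1 * T2 => f z.1 * g z.2).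
  apply: measurable_funM; apply: measurableT_comp => //.
  - exact: integrable_measurable iF.
  - exact: integrable_measurable ig.
have mE : measurable_fun setT (EFin \o (fun z : T1 * T2 => f z.1 * g z.2)).
  exact/measurable_EFinP.
apply/(@integrable12ltyP _ _ _ _ _ P Q _ mE).
rewrite (_ : (\int[P]_x \int[Q]_y _ = \int[P]_x (`|f x| * \int[Q]_y `|g y|)%:E)%E).
  rewrite EFin_Rintegral ?ltry//.
  under [X in intble _ X]eq_fun do rewrite mulrC.
  exact/intbleZ/intble_abs.
apply: eq_integral => x _.
rewrite -RintegralZl//; last exact: intble_abs.
rewrite -EFin_Rintegral//; last exact/intbleZ/intble_abs.
by apply: eq_integral => y _ /=; rewrite normrM.
Qed.

Lemma Rintegral_prod f g : intble P f -> intble Q g ->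
  \int[prob_prod]_z (f z.1 * g z.2) = \int[P]_x f x * \int[Q]_y g y.
Proof.
move=> iF ig; have ifg := intble_prod iF ig.
rewrite {1}/Rintegral -(@integral12_prod_meas1 _ _ _ _ _ P Q _ ifg).
rewrite -RintegralZr//; congr fine; apply: eq_integral => x _.
by rewrite /fubini_F EFin_Rintegral//= ?RintegralZl//; exact: intbleZ.
Qed.

Lemma intble_fst f : intble P f -> intble prob_prod (fun z => f z.1).
Proof.
move=> iF; have := intble_prod iF (integrable_cst Q 1).
by apply: eq_integrable => // z _ /=; rewrite mulr1.
Qed.

Lemma intble_snd f : intble Q f -> intble prob_prod (fun z => f z.2).
Proof.
move=> iF; have := intble_prod (integrable_cst P 1) iF.
by apply: eq_integrable => // z _ /=; rewrite mul1r.
Qed.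

End products.

(** The triple product is associated to the left, while freezing the first coordinate calls for the
    product of the last two; both are unfolded into iterated integrals. *)
Lemma fubini_triple_eq0 d1 d2 d3 (T1 : measurableType d1)
    (T2 : measurableType d2) (T3 : measurableType d3) (R : realType)
    (P1 : probability T1 R) (P2 : probability T2 R) (P3 : probability T3 R)
    (F : T1 * T2 * T3 -> R) :
  intble (prob_prod (prob_prod P1 P2) P3) F ->
  (forall x, intble (prob_prod P2 P3) (fun q => F (x, q.1, q.2)) /\
    \int[prob_prod P2 P3]_q F (x, q.1, q.2) = 0) ->
  \int[prob_prod (prob_prod P1 P2) P3]_w F w = 0.
Proof.
move=> iF F0; rewrite /Rintegral.
rewrite -(@integral12_prod_meas1 _ _ _ _ _ (prob_prod P1 P2) P3 _ iF).
have iFF := @integrable_fubini_F _ _ _ _ _ (prob_prod P1 P2) P3 _ iF.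
rewrite -(@integral12_prod_meas1 _ _ _ _ _ P1 P2 _ iFF).
rewrite (eq_integral (cst 0%E)) ?integral0// => x _.
have [iFx Fx0] := F0 x.
rewrite -[RHS]/(0%:E) -Fx0 -EFin_Rintegral//.
by rewrite -(@integral12_prod_meas1 _ _ _ _ _ P2 P3 _ iFx).
Qed.

(** * Bounds on conditional expectations and transition kernels *)

Section conditional_bound.
Context d (T : measurableType d) (R : realType).
Variable P : probability T R.

(** The event [C < Z] is in [G], so [Z - C] and [Y - C] have the same integral over it; the first is
    nonnegative there and the second nonpositive. *)
Lemma conditional_le (G : set (set T)) (Y Z : T -> R) (C : R) :
  G `<=` measurable -> intble P Y -> intble P Z -> measurable_wrt G Z ->
  (forall A, G A -> \int[P]_(w in A) Z w = \int[P]_(w in A) Y w) ->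
  (forall w, Y w <= C) -> {ae P, forall w, Z w <= C}.
Proof.
move=> Gm iY iZ GZ ZY YC; pose A := [set w | C < Z w].
have GA : G A.
  rewrite (_ : A = Z @^-1` `]C, +oo[%classic); first exact: GZ.
  by apply/seteqP; split => w /=; rewrite in_itv/= andbT.
have mA := Gm _ GA.
have iC := integrable_cst P C.
have iU := intble_indic mA (intbleB iZ iC).
have iV := intble_indic mA (intbleB iZ iY).
have ind_ge0 w : 0 <= \1_A w * (Z w - C).
  rewrite indicE; have [|_] := boolP (w \in A); rewrite ?mul0r//.
  by rewrite inE mul1r subr_ge0 => /ltW.
have : \int[P]_w (\1_A w * (Z w - C)) = 0.
  apply/eqP; rewrite eq_le Rintegral_ge0// andbT.
  rewrite (@le_trans _ _ (\int[P]_w (\1_A w * (Z w - Y w))))//.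
    apply: le_Rintegral => // w _; rewrite ler_wpM2l ?lerD2l ?lerN2//.
  rewrite -Rintegral_indic RintegralB//; [|exact: integrableS iZ|exact: integrableS iY].
  by rewrite ZY// subrr.
move=> /(Rintegral_eq0_ae iU ind_ge0); apply: filterS => w /=.
rewrite indicE; have [|] := boolP (w \in A).
  rewrite inE /A /= mul1r => CZ /eqP; rewrite subr_eq0 => /eqP ZE.
  by move: CZ; rewrite ZE ltxx.
by rewrite notin_setE /A /= => /negP; rewrite -leNgt.
Qed.

Lemma conditional_bounded (G : set (set T)) (Y Z : T -> R) (C : R) :
  G `<=` measurable -> intble P Y -> intble P Z -> measurable_wrt G Z ->
  (forall A, G A -> \int[P]_(w in A) Z w = \int[P]_(w in A) Y w) ->
  (forall w, `|Y w| <= C) -> {ae P, forall w, `|Z w| <= C}.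
Proof.
move=> Gm iY iZ GZ ZY YC.
have GN : measurable_wrt G (fun w => - Z w).
  move=> B mB; have := GZ (-%R @^-1` B); rewrite /preimage/=; apply.
  by rewrite -[X in measurable X]setTI; exact: oppr_measurable.
have h1 : {ae P, forall w, Z w <= C}.
  by apply: (conditional_le Gm iY iZ GZ ZY) => w; case/ler_normlP: (YC w).
have h2 : {ae P, forall w, - Z w <= C}.
  apply: (conditional_le Gm (intbleN iY) (intbleN iZ) GN).
    move=> A GA; have mA := Gm _ GA; rewrite !(Rintegral_indic _ A).
    under eq_Rintegral do rewrite mulrN.
    under [RHS]eq_Rintegral do rewrite mulrN.
    by rewrite !RintegralN ?intble_indic// -!(Rintegral_indic _ A) ZY.
  by move=> w; case/ler_normlP: (YC w).
by apply: filterS2 h1 h2 => w Z1 Z2; rewrite ler_norml lerNl Z2.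
Qed.

End conditional_bound.

Section strong_markov_step.
Context d (Omega : measurableType d) (R : realType).
Variables (P : probability Omega R) (F : R -> set (set Omega)).
Variable X : R -> {RV P >-> R}.
Hypotheses (fF : filtration F) (sX : strong_markov F X).
Hypothesis cX : right_continuous X.

Lemma process_measurable_at (tau : Omega -> R) : measurable_fun setT tau ->
  (forall w, 0 <= tau w) -> measurable_fun setT (fun w => X (tau w) w).
Proof. by apply: (@measurable_process_at _ _ _ (fun t => X t)). Qed.

Lemma strong_markov_step (psi : R -> R) (C t : R) :
  measurable_fun setT psi -> (forall x, `|psi x| <= C) -> 0 <= t ->
  exists u : R -> R -> R,
    [/\ measurable_fun setT (fun p : R * R => u p.1 p.2),
        forall r x, `|u r x| <= C &
        forall tau V M, finite_stopping_time F tau ->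
          measurable_wrt (stopped_sigma F tau) V -> (forall w, `|V w| <= M) ->
          \int[P]_w (V w * psi (X (tau w + t) w)) =
          \int[P]_w (V w * u (tau w) (X (tau w) w))].
Proof.
move=> mpsi psiC t0.
have bpsi : bounded_fun psi.
  exists C; split; first exact: num_real.
  by move=> x Cx y _; exact: le_trans (psiC y) (ltW Cx).
have [f [mf fP]] := sX mpsi bpsi t0.
have C0 : 0 <= C by exact: le_trans (psiC 0).
(* The kernel is truncated to be bounded and measurable everywhere; this does
   not change it almost surely. *)
pose u r x := Num.max (- C) (Num.min C (f (Num.max 0 r) x)).
have muf : measurable_fun setT (fun p : R * R => f (Num.max 0 p.1) p.2).
  apply: (@measurable_comp _ _ _ _ _ _ ([set u : R | 0 <= u] `*` [set: R])
    (fun p : R * R => f p.1 p.2) setT (fun p : R * R => (Num.max 0 p.1, p.2))).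
  - apply: measurableX => //; rewrite (_ : [set u : R | _] = `[0, +oo[%classic)//.
    by apply/seteqP; split => r /=; rewrite in_itv/= andbT.
  - by move=> _ [p _ <-]; split => //=; rewrite le_max lexx.
  - exact: mf.
  - by apply: measurable_fun_pair => //; apply: measurable_maxr.
have mu : measurable_fun setT (fun p : R * R => u p.1 p.2).
  by apply: measurable_maxr => //; apply: measurable_minr.
have uC r x : `|u r x| <= C.
  rewrite ler_norml le_max lexx/= ge_max ge_min lexx/= andbT.
  by rewrite (le_trans _ C0)// oppr_le0.
exists u; split => // tau V M stau GV VM.
have tau0 : forall w, 0 <= tau w by case: stau.
have mtau := stopping_time_measurable fF stau.
have mXt : measurable_fun setT (fun w => X (tau w + t) w).
  apply: process_measurable_at; first exact: measurable_funD.
  by move=> w; rewrite addr_ge0.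
have [Z [iY iZ GZ ZY] fZ] := fP tau stau.
have Gm := @stopped_sigma_measurable _ _ _ F tau.
have sG := stopped_sigma_algebra fF stau.
have ZY' A : stopped_sigma F tau A ->
    \int[P]_(w in A) Z w = \int[P]_(w in A) psi (X (tau w + t) w).
  by move=> GA; rewrite /Rintegral ZY.
have ZC : {ae P, forall w, `|Z w| <= C} by exact: conditional_bounded GZ ZY' _.
have mV : measurable_fun setT V by move=> _ B mB; rewrite setTI; exact/Gm/GV.
have iVY := intbleM_bounded mV VM iY; have iVZ := intbleM_bounded mV VM iZ.
(* The weight [V] passes through the conditional expectation by [pull_out]; then [Z] is almost
   surely the kernel. *)
transitivity (\int[P]_w (V w * Z w)).
  apply/eqP; rewrite eq_sym -subr_eq0 -RintegralB//; apply/eqP.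
  under eq_Rintegral do rewrite -mulrBr.
  apply: (pull_out sG Gm (intbleB iZ iY) _ GV VM) => A GA.
  have mA := Gm _ GA.
  rewrite RintegralB//; [|exact: integrableS iZ|exact: integrableS iY].
  by rewrite ZY'// subrr.
apply: ae_eq_Rintegral.
- exact: integrable_measurable iVZ.
- apply: measurable_funM => //.
  apply: (measurableT_comp (f := fun p : R * R => u p.1 p.2)
    (g := fun w => (tau w, X (tau w) w))) => //.
  by apply: measurable_fun_pair => //; exact: process_measurable_at.
- apply: filterS2 fZ ZC => w fw; rewrite ler_norml => /andP[ZC1 ZC2].
  rewrite /u (max_idPr (tau0 w)) fw; congr (_ * _).
  by rewrite (min_idPr ZC2) (max_idPr ZC1).
Qed.

End strong_markov_step.

Section stopped_functions.
Context d (T : measurableType d) (R : realType).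

Lemma measurable_wrt_comp (G : set (set T)) (Z : T -> R) (v : R -> R) :
  measurable_fun setT v -> measurable_wrt G Z -> measurable_wrt G (v \o Z).
Proof.
move=> mv GZ B mB; apply: (GZ (v @^-1` B)).
by rewrite -[X in measurable X]setTI; exact: mv.
Qed.

Lemma measurable_wrt_indicM (G : set (set T)) (A : set T) (Z : T -> R) :
  sigma_algebra setT G -> G A -> measurable_wrt G Z ->
  measurable_wrt G (fun w => \1_A w * Z w).
Proof.
move=> sG GA /(measurable_wrtE sG) mZ; apply/(measurable_wrtE sG).
apply: measurable_funM => //; apply: measurable_indic.
exact: sub_sigma_algebra.
Qed.

End stopped_functions.

Section clamp.
Variable R : realType.
Implicit Type x : R.

(** Truncation that keeps continuity, used to reach integrable payoffs from bounded ones. *)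
Definition clamp (n : nat) (x : R) := Num.max (- n%:R) (Num.min n%:R x).

Lemma clamp_bounded n x : `|clamp n x| <= n%:R.
Proof.
rewrite /clamp ler_norml le_max lexx/= ge_max ge_min lexx/= andbT.
by rewrite (@le_trans _ _ 0)// oppr_le0.
Qed.

Lemma clamp_id n x : `|x| <= n%:R -> clamp n x = x.
Proof.
by rewrite ler_norml /clamp => /andP[nx xn]; rewrite (min_idPr xn) (max_idPr nx).
Qed.

Lemma normr_clamp n x : `|clamp n x| <= `|x|.
Proof.
have [xn|nx] := leP `|x| n%:R; first by rewrite clamp_id.
exact: le_trans (clamp_bounded n x) (ltW nx).
Qed.

Lemma clamp_cvg x : clamp n x @[n --> \oo] --> x.
Proof.
apply: cvg_near_cst; have [m _ mx] : \forall n \near \oo, `|x| <= n%:R.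
  exact: nbhs_infty_ger.
by exists m => // n mn /=; apply: clamp_id; exact: mx.
Qed.

Lemma continuous_clamp n (f : R -> R) : continuous f -> continuous (clamp n \o f).
Proof.
move=> cf x.
apply: (@continuous_max R R (fun=> - n%:R) (fun y => Num.min n%:R (f y)) x).
  exact: cst_continuous.
apply: (@continuous_min R R (fun=> n%:R) f x); first exact: cst_continuous.
exact: cf.
Qed.

End clamp.

(** * Exchangeability of two copies after they meet *)

Section exchangeability.
Context d (Omega : measurableType d) (R : realType).
Variables (P : probability Omega R) (F : R -> set (set Omega)).
Variable X : R -> {RV P >-> R}.
Hypotheses (fF : filtration F) (sX : strong_markov F X).
Hypothesis cX : right_continuous X.

Let PP := prob_prod P P.

(** Fubini's theorem needs joint measurability, and the strong Markov property is used for one copy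
    with the other frozen; no filtration on the product is involved. *)
Definition separately_stopping (tau : Omega * Omega -> R) :=
  [/\ measurable_fun setT tau,
      forall y, finite_stopping_time F (fun x => tau (x, y)) &
      forall x, finite_stopping_time F (fun y => tau (x, y))].

Definition separately_stopped (tau : Omega * Omega -> R) (D : set (Omega * Omega)) :=
  [/\ measurable D,
      forall y, stopped_sigma F (fun x => tau (x, y)) [set x | D (x, y)] &
      forall x, stopped_sigma F (fun y => tau (x, y)) [set y | D (x, y)]].

Let mfst (tau : Omega * Omega -> R) :
  measurable_fun setT tau -> (forall z, 0 <= tau z) ->
  measurable_fun setT (fun z : Omega * Omega => X (tau z) z.1).
Proof.
apply: (@measurable_process_at _ _ _ (fun t (z : Omega * Omega) => X t z.1)).
  by move=> t _; exact: measurableT_comp.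
by move=> z t; exact: cX.
Qed.

Let msnd (tau : Omega * Omega -> R) :
  measurable_fun setT tau -> (forall z, 0 <= tau z) ->
  measurable_fun setT (fun z : Omega * Omega => X (tau z) z.2).
Proof.
apply: (@measurable_process_at _ _ _ (fun t (z : Omega * Omega) => X t z.2)).
  by move=> t _; exact: measurableT_comp.
by move=> z t; exact: cX.
Qed.

(** Here the variable is the time and the path is fixed: [measurable_process_at] is applied on [R]
    to a process that does not depend on its state. The maximum makes the time nonnegative. *)
Lemma path_measurable (t : R) (w : Omega) : 0 <= t ->
  measurable_fun setT (fun r : R => X (Num.max 0 r + t) w).
Proof.
move=> t0; apply: (@measurable_process_at _ _ _ (fun t (_ : R) => X t w)).
- by move=> s _; exact: measurable_cst.
- by move=> _ s; exact: cX.
- by apply: measurable_funD => //; exact: measurable_maxr.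
- by move=> r; rewrite addr_ge0// le_max lexx.
Qed.

Definition markov_kernel (psi : R -> R) (t : R) (u : R -> R -> R) :=
  forall tau V (M : R), finite_stopping_time F tau ->
    measurable_wrt (stopped_sigma F tau) V -> (forall w, `|V w| <= M) ->
    \int[P]_w (V w * psi (X (tau w + t) w)) =
    \int[P]_w (V w * u (tau w) (X (tau w) w)).

Section one_time.
Variables (tau : Omega * Omega -> R) (D : set (Omega * Omega)).
Hypotheses (stau : separately_stopping tau) (sD : separately_stopped tau D).

Let mtau : measurable_fun setT tau. Proof. by case: stau. Qed.
Let mD : measurable D. Proof. by case: sD. Qed.
Let tau0 z : 0 <= tau z.
Proof. by case: stau z => _ + _ [x y] => /(_ y)[/(_ x)]. Qed.

Variables (v : Omega -> R -> R) (psi : R -> R) (C M t : R) (u : R -> R -> R).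
Hypothesis mv : forall w, measurable_fun setT (v w).
Hypothesis vM : forall w r, `|v w r| <= M.
Hypotheses (mpsi : measurable_fun setT psi) (psiC : forall x, `|psi x| <= C).
Hypothesis mu : measurable_fun setT (fun p : R * R => u p.1 p.2).
Hypothesis uC : forall r x, `|u r x| <= C.
Hypotheses (t0 : 0 <= t) (Hu : markov_kernel psi t u).

Let bound (A : set (Omega * Omega)) z (a b : R) : `|a| <= M -> `|b| <= C ->
  `|\1_A z * a * b| <= M * C.
Proof.
move=> aM bC; rewrite !normrM -[leRHS]mul1r -mulrA.
by rewrite !ler_pM ?mulr_ge0// normr_indic.
Qed.

Let mpsiX (f : Omega * Omega -> R) : measurable_fun setT f ->
  measurable_fun setT (psi \o f).
Proof. by move=> mf; exact: measurableT_comp. Qed.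

Let muX (f : Omega * Omega -> R) : measurable_fun setT f ->
  measurable_fun setT (fun z => u (tau z) (f z)).
Proof.
move=> mf; apply: (measurableT_comp (f := fun p : R * R => u p.1 p.2)
  (g := fun z => (tau z, f z))) => //.
exact: measurable_fun_pair.
Qed.

(** With the first copy frozen, [v] is a function of the stopping time alone, hence an admissible
    weight in [markov_kernel]. It may contain the first copy at any time after [tau]. *)
Lemma markov_snd : measurable_fun setT (fun z => v z.1 (tau z)) ->
  \int[PP]_z (\1_D z * v z.1 (tau z) * psi (X (tau z + t) z.2)) =
  \int[PP]_z (\1_D z * v z.1 (tau z) * u (tau z) (X (tau z) z.2)).
Proof.
move=> mvz.
have mV : measurable_fun setT (fun z => \1_D z * v z.1 (tau z)).
  by apply: measurable_funM => //; exact: measurable_indic.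
have m1 : measurable_fun setT (fun z =>
    \1_D z * v z.1 (tau z) * psi (X (tau z + t) z.2)).
  apply: measurable_funM => //; apply: mpsiX; apply: msnd.
    exact: measurable_funD.
  by move=> z; rewrite addr_ge0.
have m2 : measurable_fun setT (fun z =>
    \1_D z * v z.1 (tau z) * u (tau z) (X (tau z) z.2)).
  by apply: measurable_funM => //; apply: muX; exact: msnd.
apply: fubini_eq1.
- by apply: (intble_bounded _ m1) => z; exact: bound.
- by apply: (intble_bounded _ m2) => z; exact: bound.
- move=> x; split.
  + apply: (@intble_bounded _ _ _ _ _ (M * C)); last by move=> y; exact: bound.
    exact: (measurableT_comp m1 (pair1_measurable x)).
  + apply: (@intble_bounded _ _ _ _ _ (M * C)); last by move=> y; exact: bound.
    exact: (measurableT_comp m2 (pair1_measurable x)).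
  + have [_ _ /(_ x) sx] := stau; have [_ _ /(_ x) dx] := sD.
    have HV : measurable_wrt (stopped_sigma F (fun y => tau (x, y)))
        (fun y => \1_[set y | D (x, y)] y * v x (tau (x, y))).
      apply: (measurable_wrt_indicM (stopped_sigma_algebra fF sx) dx).
      exact: (measurable_wrt_comp (mv x) (stopping_time_stopped fF sx)).
    apply: (Hu (V := fun y => \1_D (x, y) * v x (tau (x, y))) (M := M) sx).
      by [].
    move=> y; rewrite normrM -[leRHS]mul1r ler_pM//; exact: normr_indic.
Qed.

Lemma markov_fst : measurable_fun setT (fun z => v z.2 (tau z)) ->
  \int[PP]_z (\1_D z * v z.2 (tau z) * psi (X (tau z + t) z.1)) =
  \int[PP]_z (\1_D z * v z.2 (tau z) * u (tau z) (X (tau z) z.1)).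
Proof.
move=> mvz.
have mV : measurable_fun setT (fun z => \1_D z * v z.2 (tau z)).
  by apply: measurable_funM => //; exact: measurable_indic.
have m1 : measurable_fun setT (fun z =>
    \1_D z * v z.2 (tau z) * psi (X (tau z + t) z.1)).
  apply: measurable_funM => //; apply: mpsiX; apply: mfst.
    exact: measurable_funD.
  by move=> z; rewrite addr_ge0.
have m2 : measurable_fun setT (fun z =>
    \1_D z * v z.2 (tau z) * u (tau z) (X (tau z) z.1)).
  by apply: measurable_funM => //; apply: muX; exact: mfst.
apply: fubini_eq2.
- by apply: (intble_bounded _ m1) => z; exact: bound.
- by apply: (intble_bounded _ m2) => z; exact: bound.
- move=> y; split.
  + apply: (@intble_bounded _ _ _ _ _ (M * C)); last by move=> x; exact: bound.
    exact: (measurable_fun_pair1 y m1).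
  + apply: (@intble_bounded _ _ _ _ _ (M * C)); last by move=> x; exact: bound.
    exact: (measurable_fun_pair1 y m2).
  + have [_ /(_ y) sy _] := stau; have [_ /(_ y) dy _] := sD.
    have HV : measurable_wrt (stopped_sigma F (fun x => tau (x, y)))
        (fun x => \1_[set x | D (x, y)] x * v y (tau (x, y))).
      apply: (measurable_wrt_indicM (stopped_sigma_algebra fF sy) dy).
      exact: (measurable_wrt_comp (mv y) (stopping_time_stopped fF sy)).
    apply: (Hu (V := fun x => \1_D (x, y) * v y (tau (x, y))) (M := M) sy).
      by [].
    move=> x; rewrite normrM -[leRHS]mul1r ler_pM//; exact: normr_indic.
Qed.

End one_time.

Section exchange.
Variable tau : Omega * Omega -> R.
Hypotheses (stau : separately_stopping tau).

Let mtau : measurable_fun setT tau. Proof. by case: stau. Qed.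
Let tau0 z : 0 <= tau z.
Proof. by case: stau z => _ + _ [x y] => /(_ y)[/(_ x)]. Qed.

(* After [tau] both copies restart from the common value [X_tau], so both
   orders of [phi] and [psi] give the same product of transition kernels. *)
Lemma exchange_shift (D : set (Omega * Omega)) (phi psi : R -> R) (C t : R) :
  (forall z, D z -> X (tau z) z.1 = X (tau z) z.2) -> separately_stopped tau D ->
  measurable_fun setT phi -> measurable_fun setT psi ->
  (forall x, `|phi x| <= C) -> (forall x, `|psi x| <= C) -> 0 <= t ->
  \int[PP]_z (\1_D z * phi (X (tau z + t) z.1) * psi (X (tau z + t) z.2)) =
  \int[PP]_z (\1_D z * psi (X (tau z + t) z.1) * phi (X (tau z + t) z.2)).
Proof.
move=> XD sD mphi mpsi phiC psiC t0.
have [u [mu uC Hu]] := strong_markov_step fF sX cX mphi phiC t0.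
have [v [mv vC Hv]] := strong_markov_step fF sX cX mpsi psiC t0.
(* Both sides become products of kernels at [tau]; on [D] these are taken at the same point, so
   their order is irrelevant. *)
suff half (f g : R -> R) (uf ug : R -> R -> R) :
    measurable_fun setT f -> measurable_fun setT g ->
    (forall x, `|f x| <= C) -> (forall x, `|g x| <= C) ->
    measurable_fun setT (fun p : R * R => uf p.1 p.2) ->
    measurable_fun setT (fun p : R * R => ug p.1 p.2) ->
    (forall r x, `|uf r x| <= C) -> (forall r x, `|ug r x| <= C) ->
    markov_kernel f t uf -> markov_kernel g t ug ->
    \int[PP]_z (\1_D z * f (X (tau z + t) z.1) * g (X (tau z + t) z.2)) =
    \int[PP]_z (\1_D z * ug (tau z) (X (tau z) z.2) * uf (tau z) (X (tau z) z.1)).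
  rewrite (half phi psi u v)// (half psi phi v u)//.
  apply: eq_Rintegral => z _; rewrite indicE.
  have [|] := boolP (z \in D); last by rewrite !mul0r.
  by rewrite inE => /XD ->; rewrite mulrAC.
move=> mf mg fC gC muf mug ufC ugC Huf Hug.
have maxE z : Num.max 0 (tau z) = tau z by exact/max_idPr.
(* [a] is the weight while the second copy is replaced by its kernel, [b] the weight while the first
   one is. The delay 0 in [b] allows [path_measurable] to be reused. *)
pose a x r := f (X (Num.max 0 r + t) x).
pose b y r := ug r (X (Num.max 0 r + 0) y).
have ma x : measurable_fun setT (a x).
  by apply: measurableT_comp => //; exact: path_measurable.
have mb y : measurable_fun setT (b y).
  apply: (measurableT_comp (f := fun p : R * R => ug p.1 p.2)
    (g := fun r : R => (r, X (Num.max 0 r + 0) y))) => //.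
  by apply: measurable_fun_pair => //; exact: path_measurable.
have mta : measurable_fun setT (fun z => a z.1 (tau z)).
  under eq_fun do rewrite /a maxE.
  apply: measurableT_comp => //; apply: mfst; first exact: measurable_funD.
  by move=> z; rewrite addr_ge0.
have mtb : measurable_fun setT (fun z => b z.2 (tau z)).
  under eq_fun do rewrite /b maxE addr0.
  apply: (measurableT_comp (f := fun p : R * R => ug p.1 p.2)
    (g := fun z => (tau z, X (tau z) z.2))) => //.
  by apply: measurable_fun_pair => //; exact: msnd.
have h1 := markov_snd stau sD (v := a) (M := C) ma
  (fun x r => fC _) mg gC mug ugC t0 Hug mta.
have h2 := markov_fst stau sD (v := b) (M := C) mb
  (fun x r => ugC _ _) mf fC muf ufC t0 Huf mtb.
transitivity (\int[PP]_z (\1_D z * a z.1 (tau z) * g (X (tau z + t) z.2))).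
  by apply: eq_Rintegral => z _; rewrite /a maxE.
rewrite h1.
transitivity (\int[PP]_z (\1_D z * b z.2 (tau z) * f (X (tau z + t) z.1))).
  by apply: eq_Rintegral => z _; rewrite /a /b maxE addr0 mulrAC.
by rewrite h2; apply: eq_Rintegral => z _; rewrite /b maxE addr0.
Qed.

Variables (t1 : R) (D : set (Omega * Omega)).
Hypothesis XD : forall z, D z -> X (tau z) z.1 = X (tau z) z.2.
Hypothesis tau1 : forall z, tau z <= t1.
Hypothesis sD : separately_stopped tau D.

Let mD : measurable D. Proof. by case: sD. Qed.

(* [tau] is pushed to a time slightly after [t1] by a shift taking countably
   many values, so that only deterministic shifts are used. *)
Let shift n z : nat := (Num.truncn ((t1 - tau z) * n.+1%:R)).+1.
Let after n z : R := tau z + (shift n z)%:R / n.+1%:R.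

Let after_gt n z : t1 < after n z.
Proof.
rewrite /after -ltrBlDl ltr_pdivlMr ?ltr0n//; exact: truncnS_gt.
Qed.

Let after_cvg z : after n z @[n --> \oo] --> t1.
Proof.
apply: (@squeeze_cvgr _ _ _ _ (cst t1) (fun n => t1 + n.+1%:R^-1)).
- apply: nearW => n; rewrite ltW//=.
  rewrite /after /shift -natr1 mulrDl mul1r addrA lerD2r -lerBrDl.
  by rewrite ler_pdivrMr ?ltr0n// truncn_le mulr_ge0// subr_ge0.
- exact: cvg_cst.
- rewrite -[X in _ --> X]addr0; apply: cvgD; first exact: cvg_cst.
  exact: cvg_harmonic.
Qed.

Let slab n k := (fun z => (t1 - tau z) * n.+1%:R) @^-1` `[k%:R, k.+1%:R[%classic.

Let slabP n k z : slab n k z <-> shift n z = k.+1.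
Proof.
rewrite /slab /shift /= in_itv/=; split=> [/truncn_def ->//|[kE]].
by rewrite -kE; apply: truncn_itv; rewrite mulr_ge0// subr_ge0.
Qed.

Let mslab n k : measurable (slab n k).
Proof.
rewrite -[X in measurable X]setTI.
by apply: measurable_funM => //; exact: measurable_funB.
Qed.

Let stopped_slab n k : separately_stopped tau (D `&` slab n k).
Proof.
have [_ st1 st2] := stau; have [_ sD1 sD2] := sD.
have mB : measurable_fun setT (fun r : R => (t1 - r) * n.+1%:R).
  by apply: measurable_funM => //; exact: measurable_funB.
split; first exact: measurableI.
- move=> y; have sG := stopped_sigma_algebra fF (st1 y).
  apply: (salgI sG (sD1 y)).
  exact: (measurable_wrt_comp mB (stopping_time_stopped fF (st1 y))).
- move=> x; have sG := stopped_sigma_algebra fF (st2 x).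
  apply: (salgI sG (sD2 x)).
  exact: (measurable_wrt_comp mB (stopping_time_stopped fF (st2 x))).
Qed.

Let mafter n : measurable_fun setT (after n).
Proof.
apply: measurable_funD => //; apply: measurable_funM => //.
apply: (measurableT_comp (f := fun r : R => (Num.truncn r).+1%:R : R)
  (g := fun z => (t1 - tau z) * n.+1%:R)).
  apply: nondecreasing_measurable => // x y xy.
  by rewrite ler_nat ltnS le_truncn.
by apply: measurable_funM => //; exact: measurable_funB.
Qed.

(** At time [after n] the integral vanishes on each slab, where the delay is constant, by
    [exchange_shift]. As [after n] decreases to its limit [t1] only from strictly above, right
    continuity and dominated convergence apply. The inequality is enough, since swapping [phi] and
    [psi] reverses it. *)
Lemma exchange_bounded_ge0 (phi psi : R -> R) (C : R) :
  continuous phi -> continuous psi ->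
  (forall x, `|phi x| <= C) -> (forall x, `|psi x| <= C) ->
  0 <= \int[PP]_z (\1_D z * (phi (X t1 z.1) * psi (X t1 z.2) -
                            psi (X t1 z.1) * phi (X t1 z.2))).
Proof.
move=> cphi cpsi phiC psiC.
have mphi := continuous_measurable_fun cphi.
have mpsi := continuous_measurable_fun cpsi.
pose G (x y : R) := phi x * psi y - psi x * phi y.
have after0 n z : 0 <= after n z.
  by rewrite (le_trans (tau0 z))// (le_trans (tau1 z))// ltW.
have GC x y : `|G x y| <= C * C + C * C.
  rewrite (le_trans (ler_normB _ _))// !normrM lerD// ler_pM//.
pose U n z := \1_D z * G (X (after n z) z.1) (X (after n z) z.2).
have UC n z : `|U n z| <= C * C + C * C.
  by rewrite normrM -[leRHS]mul1r ler_pM// normr_indic.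
have mG f g : measurable_fun setT f -> measurable_fun setT g ->
    measurable_fun setT (fun z : Omega * Omega => G (f z) (g z)).
  move=> mf mg; apply: measurable_funB; apply: measurable_funM;
    exact: measurableT_comp.
have mU n : measurable_fun setT (U n).
  apply: measurable_funM; first exact: measurable_indic.
  by apply: mG; [exact: mfst|exact: msnd].
have U_ge0 n : 0 <= \int[PP]_z U n z.
  apply: (@Rintegral_partition_ge0 _ _ _ PP (slab n)) => //.
  - apply/trivIsetP => i j _ _ /eqP ij; rewrite -subset0 => z [/slabP zi /slabP].
    by rewrite zi => -[].
  - apply/seteqP; split => // z _.
    by exists (shift n z).-1; [|apply/slabP; rewrite prednK].
  - exact: intble_bounded (UC n).
  move=> k; rewrite Rintegral_indic.
  pose A := D `&` slab n k; pose t : R := k.+1%:R / n.+1%:R.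
  have t0 : 0 <= t by rewrite divr_ge0.
  have XA z : A z -> X (tau z) z.1 = X (tau z) z.2 by case=> /XD.
  have h := @exchange_shift A phi psi C t XA (stopped_slab n k) mphi mpsi phiC psiC t0.
  pose f (u v : R -> R) z := \1_A z * u (X (tau z + t) z.1) * v (X (tau z + t) z.2).
  have mA : measurable A by exact: measurableI.
  have tau_t0 z : 0 <= tau z + t by rewrite addr_ge0.
  have iF (u v : R -> R) : measurable_fun setT u -> measurable_fun setT v ->
      (forall x, `|u x| <= C) -> (forall x, `|v x| <= C) -> intble PP (f u v).
    move=> mu mv uC vC; apply: (@intble_bounded _ _ _ _ _ (1 * C * C)).
      apply: measurable_funM; [apply: measurable_funM|].
      - exact: measurable_indic.
      - by apply: measurableT_comp => //; apply: mfst => //; exact: measurable_funD.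
      - by apply: measurableT_comp => //; apply: msnd => //; exact: measurable_funD.
    by move=> z; rewrite !normrM !ler_pM ?mulr_ge0// normr_indic.
  rewrite (_ : Rintegral _ _ _ = \int[PP]_z (f phi psi z - f psi phi z)).
    by rewrite RintegralB ?iF// h subrr.
  apply: eq_Rintegral => z _; rewrite /f /U /A indicI /=.
  have [zs|zs] := boolP (z \in slab n k); last first.
    by rewrite !indicE (negbTE zs) !(mul0r, mulr0) subrr.
  rewrite /after; move: (zs); rewrite inE => /slabP ->; rewrite -/t.
  by rewrite /G !indicE zs mulr1 mul1r mulrBr !mulrA.
have t10 : 0 <= t1 by exact: le_trans (tau0 point) (tau1 point).
have Xcvg w z : X (after n z) w @[n --> \oo] --> X t1 w.
  by have /cvg_at_rightP := @cX w t1 t10; apply; split => // n; exact: after_gt.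
have comp_cvg (u : R -> R) w z : continuous u ->
    u (X (after n z) w) @[n --> \oo] --> u (X t1 w).
  by move=> cu; apply: continuous_cvg; [exact: cu|exact: Xcvg].
have U_cvg z : U n z @[n --> \oo] --> \1_D z * G (X t1 z.1) (X t1 z.2).
  apply: cvgM; first exact: cvg_cst.
  by apply: cvgB; apply: cvgM; exact: comp_cvg.
have := cvg_Rintegral mU U_cvg (integrable_cst PP _) UC.
by move=> /cvgr_to_ge; apply; exact: nearW.
Qed.

(** Truncation reduces to bounded payoffs; the dominating function [B] is integrable because the
    copies are independent. *)
Lemma exchange_ge0 (phi psi : R -> R) :
  continuous phi -> continuous psi ->
  intble P (fun w => phi (X t1 w)) -> intble P (fun w => psi (X t1 w)) ->
  0 <= \int[PP]_z (\1_D z * (phi (X t1 z.1) * psi (X t1 z.2) -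
                            psi (X t1 z.1) * phi (X t1 z.2))).
Proof.
move=> cphi cpsi iphi ipsi.
pose U n z := \1_D z * ((clamp n \o phi) (X t1 z.1) * (clamp n \o psi) (X t1 z.2) -
                        (clamp n \o psi) (X t1 z.1) * (clamp n \o phi) (X t1 z.2)).
pose B z := `|phi (X t1 z.1)| * `|psi (X t1 z.2)| +
  `|psi (X t1 z.1)| * `|phi (X t1 z.2)|.
have iB : intble PP B.
  by apply: intbleD; apply: (intble_prod (f := fun w => `|_ (X t1 w)|)
    (g := fun w => `|_ (X t1 w)|)); exact: intble_abs.
have UB n z : `|U n z| <= B z.
  rewrite normrM -[leRHS]mul1r ler_pM ?normr_indic//.
  rewrite (le_trans (ler_normB _ _))// !normrM.
  by rewrite lerD// ler_pM// normr_clamp.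
have mU n : measurable_fun setT (U n).
  have mc (f : R -> R) : continuous f -> measurable_fun setT (clamp n \o f \o X t1).
    move=> cf; apply: measurableT_comp => //.
    by apply: continuous_measurable_fun; exact: continuous_clamp.
  apply: measurable_funM; first exact: measurable_indic.
  by apply: measurable_funB; apply: measurable_funM;
    [exact: (measurableT_comp (mc _ _) measurable_fst)|
     exact: (measurableT_comp (mc _ _) measurable_snd)|
     exact: (measurableT_comp (mc _ _) measurable_fst)|
     exact: (measurableT_comp (mc _ _) measurable_snd)].
have U_cvg z : U n z @[n --> \oo] --> \1_D z * (phi (X t1 z.1) * psi (X t1 z.2) -
    psi (X t1 z.1) * phi (X t1 z.2)).
  apply: cvgM; first exact: cvg_cst.
  by apply: cvgB; apply: cvgM; exact: clamp_cvg.
have /cvgr_to_ge := cvg_Rintegral mU U_cvg iB UB; apply; apply: nearW => n.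
apply: (@exchange_bounded_ge0 _ _ n%:R); try exact: continuous_clamp;
  by move=> x; exact: clamp_bounded.
Qed.

Lemma exchange (phi psi : R -> R) :
  continuous phi -> continuous psi ->
  intble P (fun w => phi (X t1 w)) -> intble P (fun w => psi (X t1 w)) ->
  \int[PP]_z (\1_D z * (phi (X t1 z.1) * psi (X t1 z.2) -
                       psi (X t1 z.1) * phi (X t1 z.2))) = 0.
Proof.
move=> cphi cpsi iphi ipsi; apply/eqP; rewrite eq_le exchange_ge0// andbT.
have := exchange_ge0 cpsi cphi ipsi iphi.
set f := (X in 0 <= Rintegral _ _ X -> _) => h.
rewrite -oppr_ge0 -RintegralN; last first.
  apply: intble_indic => //; apply: intbleB;
  exact: (intble_prod (f := fun w => _ (X t1 w)) (g := fun w => _ (X t1 w))).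
apply: le_trans h _; rewrite le_eqVlt; apply/orP; left; apply/eqP.
by apply: eq_Rintegral => z _; rewrite /f; ring.
Qed.

End exchange.

End exchangeability.

(** * Independent copies *)

Section coinduced.
Context d1 d2 (S : measurableType d1) (T : measurableType d2) (R : realType).
Variables (I : Type) (i : I -> S -> T) (K : R -> set (set S)).
Hypothesis mi : forall j, measurable_fun setT (i j).
Hypothesis fK : filtration K.

(* The largest filtration making all the maps [i j] adapted; with [i] the
   sections of a product, it consists of the sets that are observable in each
   copy when the others are frozen. *)
Definition coinduced (t : R) : set (set T) :=
  [set D | measurable D /\ forall j, K t (i j @^-1` D)].

Lemma coinduced_filtration : filtration coinduced.
Proof.
have [sK Km Kle] := fK; split.
- move=> t t0; split.
  + by split=> // j; rewrite preimage_set0; exact: (salg0 (sK _ t0)).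
  + move=> A [mA KA]; rewrite setTD; split; first exact: measurableC.
    by move=> j; rewrite preimage_setC; exact: (salgC (sK _ t0) (KA j)).
  + move=> A KA; split; first by apply: bigcupT_measurable => n; case: (KA n).
    move=> j; rewrite preimage_bigcup; apply: (salg_bigcup (sK _ t0)) => n.
    by case: (KA n).
- by move=> t t0 A [].
- by move=> s t s0 st A [mA KA]; split => // j; apply: (Kle s t) => //; exact: KA.
Qed.

Lemma coinduced_stopping (tau : T -> R) (j : I) :
  finite_stopping_time coinduced tau -> finite_stopping_time K (tau \o i j).
Proof.
by move=> [t0 ct]; split=> [w|t t0']; [exact: t0|by case: (ct _ t0') => _ /(_ j)].
Qed.

Lemma coinduced_stopped (tau : T -> R) (D : set T) (j : I) :
  stopped_sigma coinduced tau D -> stopped_sigma K (tau \o i j) (i j @^-1` D).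
Proof.
move=> [mD cD]; split; last by move=> t t0; case: (cD t t0) => _ /(_ j).
by rewrite -[X in measurable X]setTI; exact: mi.
Qed.

End coinduced.

Section adapted.
Context d (T : measurableType d) (R : realType).

Lemma measurable_wrtB (G : set (set T)) (Y Z : T -> R) :
  sigma_algebra setT G -> measurable_wrt G Y -> measurable_wrt G Z ->
  measurable_wrt G (fun w => Y w - Z w).
Proof.
move=> sG /(measurable_wrtE sG) mY /(measurable_wrtE sG) mZ.
by apply/(measurable_wrtE sG); exact: measurable_funB.
Qed.

Lemma measurable_wrtM (G : set (set T)) (Y Z : T -> R) :
  sigma_algebra setT G -> measurable_wrt G Y -> measurable_wrt G Z ->
  measurable_wrt G (fun w => Y w * Z w).
Proof.
move=> sG /(measurable_wrtE sG) mY /(measurable_wrtE sG) mZ.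
by apply/(measurable_wrtE sG); exact: measurable_funM.
Qed.

Lemma stopped_sigma_past (H : R -> set (set T)) (tau : T -> R) (s : R) (A : set T) :
  filtration H -> finite_stopping_time H tau -> 0 <= s ->
  (forall w, s <= tau w) -> H s A -> stopped_sigma H tau A.
Proof.
move=> fH stau s0 stau_s HA; split; first exact: (filtration_measurable fH s0).
have [sH _ _] := fH.
move=> t t0; have [st|ts] := leP s t.
  apply: (salgI (sH _ t0)); first exact: (filtration_le fH s0 st).
  exact: (stopping_time_le fH stau).
rewrite (_ : _ `&` _ = set0); first exact: (salg0 (sH _ t0)).
rewrite -subset0 => w [_ /= wt].
by move: (le_lt_trans (le_trans (stau_s w) wt) ts); rewrite ltxx.
Qed.

End adapted.

(** * Order preservation for independent copies *)

Section no_crossing.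
Context d (Omega : measurableType d) (R : realType).
Variables (P : probability Omega R) (X : R -> {RV P >-> R}).
Hypothesis aX : almost_continuous X.
Context d' (Omega' : measurableType d') (Q : probability Omega' R).

Definition RV_comp (pi : Omega' -> Omega) (mpi : measurable_fun setT pi)
    (u : R) : {RV Q >-> R} :=
  HB.pack_for {mfun Omega' >-> R} (X u \o pi)
    (isMeasurableFun.Build _ _ _ _ (X u \o pi)
      (measurableT_comp (measurable_funPT (X u)) mpi)).

Lemma path_of_measurable (A : set (R -> R)) :
  path_sigma A -> measurable (path_of X @^-1` A).
Proof.
have sS : sigma_algebra setT [set A | measurable (path_of X @^-1` A)].
  split; rewrite /=.
  - by rewrite preimage_set0.
  - by move=> B mB; rewrite setTD preimage_setC; exact: measurableC.
  - by move=> B mB; rewrite preimage_bigcup; exact: bigcupT_measurable.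
move: A; apply: smallest_sub => // _ [t t0 [B mB ->]] /=.
by rewrite -[X in measurable X]setTI; exact: (measurable_funPT (X t)).
Qed.

Variables (pi1 pi2 : Omega' -> Omega).
Hypotheses (mpi1 : measurable_fun setT pi1) (mpi2 : measurable_fun setT pi2).
Hypothesis indep : forall A B, measurable A -> measurable B ->
  Q (pi1 @^-1` A `&` pi2 @^-1` B) = (P A * P B)%E.

(** With the whole space as the other event, [indep] also says that each projection has law [P]; it
    thus encodes both independence and identical distribution. *)
Let law1 A : measurable A -> Q (pi1 @^-1` A) = P A.
Proof.
move=> mA; have := indep mA measurableT.
by rewrite preimage_setT setIT [X in (_ * X)%E](probability_setT P) mule1.
Qed.

Let law2 A : measurable A -> Q (pi2 @^-1` A) = P A.
Proof.
move=> mA; have := indep measurableT mA.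
by rewrite preimage_setT setTI [X in (X * _)%E](probability_setT P) mul1e.
Qed.

Lemma no_crossing s t : 0 <= s -> s < t -> {ae Q, forall w,
  X s (pi1 w) < X s (pi2 w) ->
  (forall u, s <= u -> u < t -> X u (pi1 w) != X u (pi2 w)) ->
  X t (pi1 w) <= X t (pi2 w)}.
Proof.
move=> s0 st; have [cX _ acX] := aX.
have c1 : cadlag (RV_comp mpi1) by move=> w; exact: cX.
have c2 : cadlag (RV_comp mpi2) by move=> w; exact: cX.
have i12 : independent_processes (RV_comp mpi1) (RV_comp mpi2).
  move=> A B pA pB; have mA := path_of_measurable pA.
  have mB := path_of_measurable pB.
  exact: (etrans (indep mA mB) (esym (congr2 mule (law1 mA) (law2 mB)))).
have d1 : same_distribution X (RV_comp mpi1).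
  by move=> A /path_of_measurable mA; exact: (esym (law1 mA)).
have d2 : same_distribution X (RV_comp mpi2).
  by move=> A /path_of_measurable mA; exact: (esym (law2 mA)).
have [N [mN QN0 subN]] := acX _ Omega' Q _ _ c1 c2 i12 d1 d2 s t s0 st.
exists N; split => // w /= nw; apply: subN => /=.
move/not_implyP: nw => [sw /not_implyP[nm /negP]]; rewrite -ltNge => tw.
by split => // u su ut; apply/eqP; apply: nm => //; exact: ltW.
Qed.

End no_crossing.

Section no_crossing_symmetric.
Context d (Omega : measurableType d) (R : realType).
Variables (P : probability Omega R) (X : R -> {RV P >-> R}).
Hypothesis aX : almost_continuous X.
Context d' (Omega' : measurableType d') (Q : probability Omega' R).
Variables (pi1 pi2 : Omega' -> Omega).
Hypotheses (mpi1 : measurable_fun setT pi1) (mpi2 : measurable_fun setT pi2).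
Hypothesis indep : forall A B, measurable A -> measurable B ->
  Q (pi1 @^-1` A `&` pi2 @^-1` B) = (P A * P B)%E.

(** The sign of [e] selects which copy is on top, so both orders are treated at once. When [s < t],
    not meeting at [s] makes the initial order strict, as almost-continuity requires. *)
Lemma same_order (e s t : R) : 0 <= s -> s <= t -> {ae Q, forall w,
  0 <= e * (X s (pi2 w) - X s (pi1 w)) ->
  (forall u, s <= u -> u < t -> X u (pi1 w) != X u (pi2 w)) ->
  0 <= e * (X t (pi2 w) - X t (pi1 w))}.
Proof.
move=> s0; rewrite le_eqVlt => /predU1P[<-|st]; first by apply: aeW => w.
have indep' A B : measurable A -> measurable B ->
    Q (pi2 @^-1` A `&` pi1 @^-1` B) = (P A * P B)%E.
  by move=> mA mB; rewrite setIC indep// muleC.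
have h1 := no_crossing aX mpi1 mpi2 indep s0 st.
have h2 := no_crossing aX mpi2 mpi1 indep' s0 st.
apply: filterS2 h1 h2 => w h1 h2 es nm.
have := nm s (lexx s) st; rewrite neq_lt => /orP[lt12|lt21].
  have := h1 lt12 nm; rewrite -subr_ge0 => h; rewrite mulr_ge0//.
  by move: es; rewrite pmulr_lge0// subr_gt0.
have nm' u : s <= u -> u < t -> X u (pi2 w) != X u (pi1 w).
  by move=> su ut; rewrite eq_sym; exact: nm.
have := h2 lt21 nm'; rewrite -subr_le0 => h; rewrite mulr_le0//.
by move: es; rewrite nmulr_lge0// subr_lt0.
Qed.

End no_crossing_symmetric.

Lemma lipschitz_continuous (R : realType) (k : R) (g : R -> R) :
  (forall x y, `|g x - g y| <= k * `|x - y|) -> continuous g.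
Proof.
move=> gk x; apply/cvgrPdist_lt => e e0.
have k1 : 0 < `|k| + 1 by rewrite ltr_wpDl.
near=> y; rewrite (le_lt_trans (gk x y))//.
rewrite (@le_lt_trans _ _ ((`|k| + 1) * `|x - y|))//.
  by rewrite ler_wpM2r// (le_trans (ler_norm k))// lerDl.
rewrite mulrC -ltr_pdivlMr//; near: y.
have ek : 0 < e / (`|k| + 1) by rewrite divr_gt0.
exact: (@cvgr_dist_lt _ _ _ (nbhs x) _ id x (@cvg_id _ (nbhs x)) _ ek).
Unshelve. all: by end_near. Qed.

Lemma salg_cst T (G : set (set T)) (B : Prop) : sigma_algebra setT G ->
  G [set _ | B].
Proof.
move=> [G0 GC _]; have [b|nb] := pselect B.
  rewrite (_ : [set _ | B] = setT `\` set0); first exact: GC.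
  by apply/seteqP; split => // x _; split.
by rewrite (_ : [set _ | B] = set0)// -subset0.
Qed.

(** * Inequalities for two and three copies *)

Section copies.
Context d (Omega : measurableType d) (R : realType).
Variables (P : probability Omega R) (F : R -> set (set Omega)).
Variable X : R -> {RV P >-> R}.
Hypotheses (fF : filtration F) (mX : martingale F X).
Hypotheses (sX : strong_markov F X) (aX : almost_continuous X).
Variables (s t1 : R).
Hypotheses (s0 : 0 <= s) (st1 : s <= t1).

Let t10 : 0 <= t1. Proof. exact: le_trans s0 st1. Qed.

Let cX : right_continuous X.
Proof. by move=> w t t0; case: aX => /(_ w)[+ _] _ _; exact. Qed.

Let adX t : 0 <= t -> measurable_wrt (F t) (X t).
Proof. by case: mX => + _ _; exact. Qed.

Lemma process_intble t : 0 <= t -> intble P (X t).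
Proof. by case: mX => _ + _; exact. Qed.

(** An unnormalized conditional mean; the form with an indicator factorizes over products of
    events. *)
Definition on_event (A : set Omega) (f : Omega -> R) : R :=
  \int[P]_w (\1_A w * f w).

Lemma martingale_on_event A : F s A -> on_event A (X t1) = on_event A (X s).
Proof.
move=> FA; have [_ _ /(_ s t1 s0 st1)[Z [_ iZ FZ ZX] XZ]] := mX.
have mA := filtration_measurable fF s0 FA.
transitivity (on_event A Z).
  rewrite /on_event -!(Rintegral_indic _ A) /Rintegral ZX//.
apply: ae_eq_Rintegral.
- by apply: measurable_funM; [exact: measurable_indic|exact: integrable_measurable iZ].
- by apply: measurable_funM; [exact: measurable_indic|].
- by apply: filterS XZ => w ->.
Qed.

Lemma lipschitz_intble (k : R) (g : R -> R) t : 0 <= t ->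
  (forall x y, `|g x - g y| <= k * `|x - y|) -> intble P (fun w => g (X t w)).
Proof.
move=> t0 gk.
apply: (@intble_le _ _ _ _ _ (fun w => `|g 0| + k * `|X t w|)).
- apply: measurableT_comp => //; apply: continuous_measurable_fun.
  exact: lipschitz_continuous gk.
- apply: intbleD; first exact: integrable_cst.
  exact/intbleZ/intble_abs/process_intble.
- move=> w; rewrite -[g (X t w)](subrK (g 0)) (le_trans (ler_normD _ _))//.
  by rewrite addrC lerD2l (le_trans (gk _ _))// subr0.
Qed.

Definition slice2 (j : Omega + Omega) : Omega -> Omega * Omega :=
  match j with inl y => fun x => (x, y) | inr x => fun y => (x, y) end.

(** Only the outer copies are ever frozen: the remaining pair then contains the middle copy, and
    only its meetings matter. *)
Definition slice3 (j : Omega + Omega) : Omega * Omega -> Omega * Omega * Omega :=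
  match j with inl z => fun p => (p, z) | inr x => fun q => (x, q.1, q.2) end.

Lemma measurable_slice2 j : measurable_fun setT (slice2 j).
Proof.
by case: j => w; apply: measurable_fun_pair => //; exact: measurable_cst.
Qed.

Lemma measurable_slice3 j : measurable_fun setT (slice3 j).
Proof.
case: j => w; first by apply: measurable_fun_pair => //; exact: measurable_cst.
apply: measurable_fun_pair => //.
by apply: measurable_fun_pair => //; exact: measurable_cst.
Qed.

Definition F2 : R -> set (set (Omega * Omega)) := coinduced slice2 F.
Definition F3 : R -> set (set (Omega * Omega * Omega)) := coinduced slice3 F2.

Lemma filtration_F2 : filtration F2.
Proof. exact: coinduced_filtration. Qed.

Lemma filtration_F3 : filtration F3.
Proof. exact/coinduced_filtration/filtration_F2. Qed.

Section lifted_events.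
Variables (t : R) (A : set Omega).
Hypotheses (t0 : 0 <= t) (FA : F t A).

Let sF : sigma_algebra setT (F t). Proof. by case: fF => /(_ t t0). Qed.
Let sF2 : sigma_algebra setT (F2 t).
Proof. by case: filtration_F2 => /(_ t t0). Qed.
Let mA : measurable A. Proof. exact: (filtration_measurable fF t0 FA). Qed.

Lemma F2_fst : F2 t [set p | A p.1].
Proof.
split; first by rewrite -[X in measurable X]setTI; exact: measurable_fst.
by case=> w //=; exact: (@salg_cst _ _ (A w) sF).
Qed.

Lemma F2_snd : F2 t [set p | A p.2].
Proof.
split; first by rewrite -[X in measurable X]setTI; exact: measurable_snd.
by case=> w //=; exact: (@salg_cst _ _ (A w) sF).
Qed.

Lemma F3_1 : F3 t [set w | A w.1.1].
Proof.
split; last by case=> w /=; [exact: F2_fst|exact: (@salg_cst _ _ (A w) sF2)].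
rewrite -[X in measurable X]setTI.
exact: (measurableT_comp measurable_fst measurable_fst).
Qed.

Lemma F3_2 : F3 t [set w | A w.1.2].
Proof.
split; last by case=> w /=; [exact: F2_snd|exact: F2_fst].
rewrite -[X in measurable X]setTI.
exact: (measurableT_comp measurable_snd measurable_fst).
Qed.

Lemma F3_3 : F3 t [set w | A w.2].
Proof.
split; last by case=> w /=; [exact: (@salg_cst _ _ (A w) sF2)|exact: F2_snd].
by rewrite -[X in measurable X]setTI; exact: measurable_snd.
Qed.

End lifted_events.

Let PP := prob_prod P P.
Let PPP := prob_prod PP P.

Lemma F2_stopping tau : finite_stopping_time F2 tau -> separately_stopping F tau.
Proof.
move=> stau; split; first exact: (stopping_time_measurable filtration_F2 stau).
- by move=> y; exact: (coinduced_stopping (inl y) stau).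
- by move=> x; exact: (coinduced_stopping (inr x) stau).
Qed.

Lemma F2_stopped tau D : stopped_sigma F2 tau D -> separately_stopped F tau D.
Proof.
move=> sD; split; first by case: sD.
- by move=> y; exact: (coinduced_stopped measurable_slice2 (inl y) sD).
- by move=> x; exact: (coinduced_stopped measurable_slice2 (inr x) sD).
Qed.

Section two_copies.
Variables (g : R -> R) (k : R).
Hypothesis gk : forall x y, `|g x - g y| <= k * `|x - y|.

Let ig := lipschitz_intble t10 gk.
Let iX := process_intble t10.
Let cg := lipschitz_continuous gk.

(** Each of the two terms is treated with the other copy frozen, where the slice of [E] is in
    [F s]. *)
Lemma martingale_copies (E : set (Omega * Omega)) : F2 s E ->
  \int[PP]_z (\1_E z * (X t1 z.2 - X t1 z.1)) =
  \int[PP]_z (\1_E z * (X s z.2 - X s z.1)).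
Proof.
move=> FE; have mE := filtration_measurable filtration_F2 s0 FE.
have iXs := process_intble s0.
have split_int t : intble P (X t) -> \int[PP]_z (\1_E z * (X t z.2 - X t z.1)) =
    \int[PP]_z (\1_E z * X t z.2) - \int[PP]_z (\1_E z * X t z.1).
  move=> iXt; rewrite -RintegralB//; last 2 first.
  - exact: (intble_indic mE (intble_snd P _)).
  - exact: (intble_indic mE (intble_fst P _)).
  by apply: eq_Rintegral => z _; rewrite mulrBr.
rewrite !split_int//; case: FE => _ FE; congr (_ - _).
- apply: fubini_eq1.
  + exact: (intble_indic mE (intble_snd P _)).
  + exact: (intble_indic mE (intble_snd P _)).
  move=> x; have FEx := FE (inr x); have mEx := filtration_measurable fF s0 FEx.
  split; [exact: (intble_indic mEx iX)|exact: (intble_indic mEx iXs)|].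
  exact: (martingale_on_event FEx).
- apply: fubini_eq2.
  + exact: (intble_indic mE (intble_fst P _)).
  + exact: (intble_indic mE (intble_fst P _)).
  move=> y; have FEy := FE (inl y); have mEy := filtration_measurable fF s0 FEy.
  split; [exact: (intble_indic mEy iX)|exact: (intble_indic mEy iXs)|].
  exact: (martingale_on_event FEy).
Qed.

(* Up to the first meeting time the copies keep their order; on the event that
   they meet before [t1] the two sides agree by exchangeability. *)
Lemma two_copies (E : set (Omega * Omega)) (e : R) : F2 s E -> `|e| = 1 ->
  (forall z, E z -> 0 <= e * (X s z.2 - X s z.1)) ->
  \int[PP]_z (\1_E z * (g (X t1 z.2) - g (X t1 z.1))) <=
  k * (e * \int[PP]_z (\1_E z * (X s z.2 - X s z.1))).
Proof.
move=> FE e1 Ee; have mE := filtration_measurable filtration_F2 s0 FE.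
pose W t (z : Omega * Omega) := X t z.2 - X t z.1.
have aW t : 0 <= t -> measurable_wrt (F2 t) (W t).
  move=> t0; have [sF2 _ _] := filtration_F2.
  apply: (measurable_wrtB (sF2 _ t0)) => B mB.
    exact: (F2_snd t0 (adX t0 mB)).
  exact: (F2_fst t0 (adX t0 mB)).
have cW : right_continuous W.
  by move=> z t t0; apply: cvgB; exact: cX.
have [tau [[stau tau_st zf] tau_ae]] :=
  first_zero PP filtration_F2 aW cW s0 st1.
(* The part of [E] where the copies have met by [t1], up to a null set. *)
pose D := E `&` [set z | W (tau z) z = 0].
have sD : stopped_sigma F2 tau D.
  apply: (salgI (stopped_sigma_algebra filtration_F2 stau)).
    apply: (stopped_sigma_past filtration_F2 stau s0 _ FE) => z.
    by case/andP: (tau_st z).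
  exact: (stopped_process filtration_F2 stau aW cW (measurable_set1 0)).
have mD : measurable D by case: sD.
have XD z : D z -> X (tau z) z.1 = X (tau z) z.2.
  by move=> [_ /eqP]; rewrite subr_eq0 => /eqP.
have tau_t1 z : tau z <= t1 by case/andP: (tau_st z).
have exch psi : continuous psi -> intble P (fun w => psi (X t1 w)) ->
    \int[PP]_z (\1_D z * (psi (X t1 z.2) - psi (X t1 z.1))) = 0.
  move=> cpsi ipsi.
  have c1 : continuous (fun _ : R => 1 : R) by exact: cst_continuous.
  have := exchange fF sX cX (F2_stopping stau) XD tau_t1 (F2_stopped sD)
    c1 cpsi (integrable_cst P 1) ipsi.
  by move=> <-; apply: eq_Rintegral => z _; rewrite mul1r mulr1.
(* The excess of the payoff increment over its Lipschitz bound: nonpositive where the order given by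
   [e] persists, and of zero integral over [D] by exchangeability. *)
pose f z := (g (X t1 z.2) - g (X t1 z.1)) - k * e * (X t1 z.2 - X t1 z.1).
have igB : intble PP (fun z => g (X t1 z.2) - g (X t1 z.1)).
  exact: (intbleB (intble_snd P ig) (intble_fst P ig)).
have iXB : intble PP (fun z => X t1 z.2 - X t1 z.1).
  exact: (intbleB (intble_snd P iX) (intble_fst P iX)).
have split_f (A : set (Omega * Omega)) : measurable A ->
    \int[PP]_z (\1_A z * f z) = \int[PP]_z (\1_A z * (g (X t1 z.2) - g (X t1 z.1))) -
      k * e * \int[PP]_z (\1_A z * (X t1 z.2 - X t1 z.1)).
  move=> mA; rewrite -RintegralZl//; last exact: intble_indic.
  rewrite -RintegralB//; [|exact: intble_indic|exact/intbleZ/intble_indic].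
  by apply: eq_Rintegral => z _; rewrite /f; ring.
(* The increment of [X] at [s] is traded for the one at [t1]; it remains to compare the integrals of
   [f] over [E] and over [D]. *)
rewrite mulrA -martingale_copies// -subr_le0 -split_f//.
rewrite (_ : 0 = \int[PP]_z (\1_D z * f z)); last first.
  have cid : continuous (@id R) by move=> x; exact: cvg_id.
  by rewrite split_f// exch// (exch id cid iX) mulr0 subr0.
have if_ : intble PP f by apply: intbleB => //; exact: intbleZ.
apply: ae_le_Rintegral; [exact: intble_indic|exact: intble_indic|].
have indep A B : measurable A -> measurable B ->
    PP (fst @^-1` A `&` snd @^-1` B) = (P A * P B)%E.
  by move=> mA mB; exact: product_measure1E.
have so := same_order aX (Q := PP) measurable_fst measurable_snd indep e s0 st1.
apply: filterS2 so tau_ae => z so tz; rewrite /D indicI /= !indicE.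
have [zE|zE] := boolP (z \in E); last by rewrite !mul0r.
rewrite !mul1r; have [zW|zW] := boolP (z \in _); first by rewrite mul1r.
rewrite mul0r /f subr_le0.
have tz1 : tau z = t1.
  by case: tz => // Wz; move: zW; rewrite notin_setE.
have b0 : 0 <= e * (X t1 z.2 - X t1 z.1).
  apply: so; first by apply: Ee; move: zE; rewrite inE.
  move=> u su ut; have := zf z u su; rewrite tz1 => /(_ ut).
  by rewrite /W subr_eq0 eq_sym.
rewrite (le_trans (ler_norm _))// (le_trans (gk _ _))//.
by rewrite -mulrA -(ger0_norm b0) normrM e1 mul1r.
Qed.

End two_copies.

Section three_copies.
Variables (g : R -> R) (k : R).
Hypothesis gk : forall x y, `|g x - g y| <= k * `|x - y|.

Let ig : intble P (fun w => g (X t1 w)) := lipschitz_intble t10 gk.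
Let iX : intble P (X t1) := process_intble t10.
Let cg := lipschitz_continuous gk.

Let comb (a b c : R) (p : Omega * Omega) : R :=
  a * (g (X t1 p.2) - g (X t1 p.1)) +
  b * (X t1 p.1 * g (X t1 p.2) - g (X t1 p.1) * X t1 p.2) +
  c * (X t1 p.2 - X t1 p.1).

Let exchange_comb (tau : Omega * Omega -> R) (D : set (Omega * Omega)) a b c :
  separately_stopping F tau -> separately_stopped F tau D ->
  (forall p, D p -> X (tau p) p.1 = X (tau p) p.2) ->
  (forall p, tau p <= t1) ->
  intble PP (fun p => \1_D p * comb a b c p) /\
  \int[PP]_p (\1_D p * comb a b c p) = 0.
Proof.
move=> stau sD XD taut; have mD : measurable D by case: sD.
have c1 : continuous (fun _ : R => 1 : R) by exact: cst_continuous.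
have cid : continuous (@id R) by move=> x; exact: cvg_id.
have i1 := integrable_cst P 1.
have exch phi psi := @exchange _ _ _ P F X fF sX cX tau stau t1 D XD taut sD phi psi.
have iE (phi psi : R -> R) : intble P (fun w => phi (X t1 w)) ->
    intble P (fun w => psi (X t1 w)) -> intble PP (fun p => \1_D p *
      (phi (X t1 p.1) * psi (X t1 p.2) - psi (X t1 p.1) * phi (X t1 p.2))).
  move=> iphi ipsi; apply: intble_indic => //.
  by apply: intbleB; [exact: (intble_prod iphi ipsi)|exact: (intble_prod ipsi iphi)].
have combE p : \1_D p * comb a b c p =
    a * (\1_D p * (1 * g (X t1 p.2) - g (X t1 p.1) * 1)) +
    b * (\1_D p * (X t1 p.1 * g (X t1 p.2) - g (X t1 p.1) * X t1 p.2)) +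
    c * (\1_D p * (1 * X t1 p.2 - X t1 p.1 * 1)).
  by rewrite /comb; ring.
have iA := iE (fun=> 1) g i1 ig; have iB := iE id g iX ig.
have iC := iE (fun=> 1) id i1 iX.
have iA' := intbleZ a iA; have iB' := intbleZ b iB; have iC' := intbleZ c iC.
have iAB := intbleD iA' iB'.
split.
  by apply: eq_integrable (intbleD iAB iC') => // p _; congr EFin; rewrite combE.
rewrite (eq_Rintegral _ (fun p _ => combE p)).
rewrite (RintegralD _ iAB iC')// (RintegralD _ iA' iB')//.
rewrite (RintegralZl _ _ iA)// (RintegralZl _ _ iB)// (RintegralZl _ _ iC)//.
rewrite (exch (fun=> 1) g c1 cg i1 ig) (exch id g cid cg iX ig).
rewrite (exch (fun=> 1) id c1 cid i1 iX).
by rewrite !mulr0 !addr0.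
Qed.

Let prod3 (f h l : Omega -> R) (w : Omega * Omega * Omega) : R :=
  f w.1.1 * h w.1.2 * l w.2.

Let intble_prod3 f h l : intble P f -> intble P h -> intble P l ->
  intble PPP (prod3 f h l).
Proof. by move=> iF ih il; exact: (intble_prod (intble_prod iF ih) il). Qed.

(** Minus the determinant of the rows [(1, x, g x)], [(1, y, g y)], [(1, z, g z)]; for ordered
    arguments its sign expresses convexity. *)
Let det (x y z : R) : R :=
  (z - x) * g y - (z - y) * g x - (y - x) * g z.

Hypothesis g_det : forall x y z, x <= y -> y <= z -> det x y z <= 0.

Let detX (w : Omega * Omega * Omega) : R :=
  det (X t1 w.1.1) (X t1 w.1.2) (X t1 w.2).

(* With one copy frozen, the determinant is a combination of expressions that
   are antisymmetric in the two others. *)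
Let detXE w : detX w = comb (X t1 w.2) (- 1) (- g (X t1 w.2)) w.1.
Proof. by rewrite /detX /det /comb; ring. Qed.

Let detXE' w : detX w = comb (X t1 w.1.1) (- 1) (- g (X t1 w.1.1)) (w.1.2, w.2).
Proof. by rewrite /detX /det /comb /=; ring. Qed.

Let det_sum (a b c d e f : R) := a - b - c + d - e + f.

Let intble_detX : intble PPP detX.
Proof.
have i1 := integrable_cst P 1.
have gX := ig.
pose G := fun w => g (X t1 w).
apply: (@eq_integrable _ _ _ PPP _ measurableT (EFin \o (fun w => det_sum
  (prod3 (fun=> 1) G (X t1) w) (prod3 (X t1) G (fun=> 1) w)
  (prod3 G (fun=> 1) (X t1) w) (prod3 G (X t1) (fun=> 1) w)
  (prod3 (fun=> 1) (X t1) G w) (prod3 (X t1) (fun=> 1) G w)))).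
  by move=> w _ /=; congr EFin; rewrite /det_sum /prod3 /G /detX /det; ring.
by apply: intbleD; [apply: intbleB; [apply: intbleD; [apply: intbleB;
  [apply: intbleB|]|]|]|]; exact: intble_prod3.
Qed.

(** The product [W] of the two gaps vanishes exactly when the middle copy meets an outer one. If
    this does not happen before [t1], the order survives and [g_det] applies; otherwise antisymmetry
    in the pair that met gives a zero integral. *)
Lemma three_copies (E : set (Omega * Omega * Omega)) : F3 s E ->
  (forall w, E w -> X s w.1.1 <= X s w.1.2 /\ X s w.1.2 <= X s w.2) ->
  \int[PPP]_w (\1_E w * detX w) <= 0.
Proof.
move=> FE Ele; have mE := filtration_measurable filtration_F3 s0 FE.
have [sF3 _ _] := filtration_F3.
pose W1 t (w : Omega * Omega * Omega) := X t w.1.2 - X t w.1.1.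
pose W2 t (w : Omega * Omega * Omega) := X t w.2 - X t w.1.2.
have aW1 t : 0 <= t -> measurable_wrt (F3 t) (W1 t).
  move=> t0; apply: (measurable_wrtB (sF3 _ t0)) => B mB.
    exact: (F3_2 t0 (adX t0 mB)).
  exact: (F3_1 t0 (adX t0 mB)).
have aW2 t : 0 <= t -> measurable_wrt (F3 t) (W2 t).
  move=> t0; apply: (measurable_wrtB (sF3 _ t0)) => B mB.
    exact: (F3_3 t0 (adX t0 mB)).
  exact: (F3_2 t0 (adX t0 mB)).
have cW1 : right_continuous W1 by move=> w t t0; apply: cvgB; exact: cX.
have cW2 : right_continuous W2 by move=> w t t0; apply: cvgB; exact: cX.
pose W t w := W1 t w * W2 t w.
have aW t : 0 <= t -> measurable_wrt (F3 t) (W t).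
  by move=> t0; apply: (measurable_wrtM (sF3 _ t0)); [exact: aW1|exact: aW2].
have cW : right_continuous W.
  by move=> w t t0; apply: cvgM; [exact: cW1|exact: cW2].
have [tau [[stau tau_st zf] tau_ae]] :=
  first_zero PPP filtration_F3 aW cW s0 st1.
have tau_t1 w : tau w <= t1 by case/andP: (tau_st w).
have sS := stopped_sigma_algebra filtration_F3 stau.
have sE : stopped_sigma F3 tau E.
  apply: (stopped_sigma_past filtration_F3 stau s0 _ FE) => w.
  by case/andP: (tau_st w).
pose M1 := [set w | W1 (tau w) w = 0]; pose M2 := [set w | W2 (tau w) w = 0].
have sM1 : stopped_sigma F3 tau M1.
  exact: (stopped_process filtration_F3 stau aW1 cW1 (measurable_set1 0)).
have sM2 : stopped_sigma F3 tau M2.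
  exact: (stopped_process filtration_F3 stau aW2 cW2 (measurable_set1 0)).
(* [D2] excludes [M1], so the two meeting events are disjoint and their integrals can be added. *)
pose D1 := E `&` M1; pose D2 := (E `\` M1) `&` M2.
have sD1 : stopped_sigma F3 tau D1 by exact: salgI.
have sD2 : stopped_sigma F3 tau D2 by apply: salgI => //; exact: salgD.
have mD1 : measurable D1 by case: sD1.
have mD2 : measurable D2 by case: sD2.
(* On [D1] the first two copies have met, so the third is frozen; on [D2] it is the first one that
   is frozen. *)
have zero1 : \int[PPP]_w (\1_D1 w * detX w) = 0.
  rewrite (@fubini_eq2 _ _ _ _ _ PP P _ (fun=> 0)).
  - by rewrite Rintegral_prob_cst.
  - exact: intble_indic.
  - exact: integrable_cst.
  move=> z; rewrite Rintegral_prob_cst.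
  have sz := coinduced_stopping (inl z) stau.
  have sDz := coinduced_stopped measurable_slice3 (inl z) sD1.
  have [iz z0] := exchange_comb (X t1 z) (- 1) (- g (X t1 z))
    (F2_stopping sz) (F2_stopped sDz)
    (fun p Dp => esym (subr0_eq Dp.2)) (fun p => tau_t1 (p, z)).
  split; last first.
  + by rewrite -[RHS]z0; apply: eq_Rintegral => p _; rewrite detXE.
  + exact: integrable_cst.
  + by apply: eq_integrable iz => // p _ /=; rewrite detXE.
have zero2 : \int[PPP]_w (\1_D2 w * detX w) = 0.
  apply: fubini_triple_eq0; first exact: intble_indic.
  move=> x.
  have sx := coinduced_stopping (inr x) stau.
  have sDx := coinduced_stopped measurable_slice3 (inr x) sD2.
  have [ix x0] := exchange_comb (X t1 x) (- 1) (- g (X t1 x))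
    (F2_stopping sx) (F2_stopped sDx)
    (fun q Dq => esym (subr0_eq Dq.2)) (fun q => tau_t1 (x, q.1, q.2)).
  split.
  + by apply: eq_integrable ix => // -[y z] _ /=; rewrite detXE'.
  + by rewrite -[RHS]x0; apply: eq_Rintegral => -[y z] _; rewrite detXE'.
(* The bound 0 is written as the sum of the two vanishing integrals, which leaves an almost sure
   comparison of integrands. *)
rewrite -[leRHS](addr0 0) -{1}zero1 -zero2 -RintegralD//; last 2 first.
- exact: intble_indic.
- exact: intble_indic.
apply: ae_le_Rintegral; first exact: intble_indic.
  by apply: intbleD; exact: intble_indic.
have mp1 : measurable_fun setT (fun w : Omega * Omega * Omega => w.1.1).
  exact: (measurableT_comp measurable_fst measurable_fst).
have mp2 : measurable_fun setT (fun w : Omega * Omega * Omega => w.1.2).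
  exact: (measurableT_comp measurable_snd measurable_fst).
have indep12 A B : measurable A -> measurable B ->
    PPP ((fun w => w.1.1) @^-1` A `&` (fun w => w.1.2) @^-1` B) = (P A * P B)%E.
  move=> mA mB; have mAB : measurable (A `*` B) by exact: measurableX.
  rewrite (_ : _ `&` _ = (A `*` B) `*` setT); last first.
    by apply/seteqP; split => w /= [].
  rewrite [LHS](product_measure1E PP P mAB measurableT).
  rewrite [X in (_ * X)%E](probability_setT P) mule1.
  exact: product_measure1E.
have indep23 A B : measurable A -> measurable B ->
    PPP ((fun w => w.1.2) @^-1` A `&` snd @^-1` B) = (P A * P B)%E.
  move=> mA mB; have mTA : measurable ([set: Omega] `*` A) by exact: measurableX.
  rewrite (_ : _ `&` _ = (setT `*` A) `*` B); last first.
    by apply/seteqP; split => w /= []; [|case].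
  rewrite [LHS](product_measure1E PP P mTA mB); congr (_ * _)%E.
  rewrite [LHS](product_measure1E P P measurableT mA).
  by rewrite [X in (X * _)%E](probability_setT P) mul1e.
have so12 := same_order aX (Q := PPP) mp1 mp2 indep12 1 s0 st1.
have so23 := same_order aX (Q := PPP) mp2 measurable_snd indep23 1 s0 st1.
apply: filterS3 so12 so23 tau_ae => w so12 so23 tw.
rewrite -mulrDl /D1 /D2 setDE !indicE !in_setI in_setC.
have [wE|wE] := boolP (w \in E); last by rewrite /= add0r !mul0r.
rewrite /=; have [w1|w1] := boolP (w \in M1); first by rewrite addr0.
rewrite /=; have [w2|w2] := boolP (w \in M2); first by rewrite add0r.
rewrite /= addr0 mul0r mul1r.
move: w1 w2; rewrite !notin_setE /M1 /M2 /= => /eqP w1 /eqP w2.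
have tw1 : tau w = t1.
  by case: tw => // /eqP; rewrite mulf_eq0 (negbTE w1) (negbTE w2).
move: wE; rewrite inE => /Ele[le12 le23].
have nm u : s <= u -> u < t1 -> W1 u w != 0 /\ W2 u w != 0.
  by move=> su ut; have := zf w u su; rewrite tw1 mulf_eq0 negb_or => /(_ ut)/andP.
apply: g_det; rewrite -subr_ge0 -[leRHS]mul1r.
- apply: so12; first by rewrite mul1r subr_ge0.
  by move=> u su ut; have [+ _] := nm u su ut; rewrite subr_eq0 eq_sym.
- apply: so23; first by rewrite mul1r subr_ge0.
  by move=> u su ut; have [_ +] := nm u su ut; rewrite subr_eq0 eq_sym.
Qed.

End three_copies.

End copies.

(** * Inequalities between integrals over events *)

Section events.
Context d (Omega : measurableType d) (R : realType).
Variable P : probability Omega R.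
Implicit Types (A B C : set Omega) (f h : Omega -> R).

Lemma on_event_ge0 A f : (forall w, A w -> 0 <= f w) -> 0 <= on_event P A f.
Proof.
move=> f0; apply: Rintegral_ge0 => w _; rewrite indicE.
by have [|_] := boolP (w \in A); rewrite ?mul0r// inE mul1r => /f0.
Qed.

Lemma on_eventD A f h : measurable A -> intble P f -> intble P h ->
  on_event P A (fun w => f w + h w) = on_event P A f + on_event P A h.
Proof.
move=> mA iF ih; rewrite /on_event -RintegralD//; [|exact: intble_indic..].
by apply: eq_Rintegral => w _; rewrite mulrDr.
Qed.

Lemma on_eventZ A f c : measurable A -> intble P f ->
  on_event P A (fun w => c * f w) = c * on_event P A f.
Proof.
move=> mA iF; rewrite /on_event -RintegralZl//; last exact: intble_indic.
by apply: eq_Rintegral => w _; rewrite mulrCA.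
Qed.

Lemma on_eventB A f h : measurable A -> intble P f -> intble P h ->
  on_event P A (fun w => f w - h w) = on_event P A f - on_event P A h.
Proof.
move=> mA iF ih; rewrite -[X in _ = _ + X]mulN1r -on_eventZ// -on_eventD//.
  by congr on_event; apply/funext => w; rewrite mulN1r.
exact: intbleZ.
Qed.

Lemma on_event_le A f h : measurable A -> intble P f -> intble P h ->
  (forall w, A w -> f w <= h w) -> on_event P A f <= on_event P A h.
Proof.
move=> mA iF ih fh; rewrite -subr_ge0 -on_eventB//.
by apply: on_event_ge0 => w /fh; rewrite subr_ge0.
Qed.

Lemma on_event_split A B f : measurable A -> measurable B -> intble P f ->
  on_event P A f = on_event P (A `&` B) f + on_event P (A `\` B) f.
Proof.
move=> mA mB iF.
have mI : measurable (A `&` B) by exact: measurableI.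
have mD : measurable (A `\` B) by exact: measurableD.
rewrite /on_event -RintegralD//; [|exact: intble_indic..].
apply: eq_Rintegral => w _; rewrite -mulrDl; congr (_ * _).
rewrite setDE !indicE !in_setI in_setC.
by case: (w \in A); case: (w \in B); rewrite /= ?addr0 ?add0r.
Qed.

Lemma on_event_setT f : on_event P setT f = \int[P]_w f w.
Proof. by apply: eq_Rintegral => w _; rewrite indicE in_setT mul1r. Qed.

Let PP := prob_prod P P.

Lemma rectangle_diff A B f : measurable A -> measurable B -> intble P f ->
  \int[PP]_z (\1_A z.1 * \1_B z.2 * (f z.2 - f z.1)) =
  on_event P A (fun=> 1) * on_event P B f - on_event P A f * on_event P B (fun=> 1).
Proof.
move=> mA mB iF; have i1 := integrable_cst P 1.
have iAf := intble_indic mA iF; have iBf := intble_indic mB iF.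
have iA1 := intble_indic mA i1; have iB1 := intble_indic mB i1.
rewrite /on_event -(Rintegral_prod iA1 iBf) -(Rintegral_prod iAf iB1).
rewrite -RintegralB//; [|exact: (intble_prod iA1 iBf)|exact: (intble_prod iAf iB1)].
by apply: eq_Rintegral => z _; ring.
Qed.

End events.

Section event_inequalities.
Context d (Omega : measurableType d) (R : realType).
Variables (P : probability Omega R) (F : R -> set (set Omega)).
Variable X : R -> {RV P >-> R}.
Hypotheses (fF : filtration F) (mX : martingale F X).
Hypotheses (sX : strong_markov F X) (aX : almost_continuous X).
Variables (s t1 : R).
Hypotheses (s0 : 0 <= s) (st1 : s <= t1).

Let t10 : 0 <= t1. Proof. exact: le_trans s0 st1. Qed.
Let PP := prob_prod P P.
Let iXs := process_intble mX s0.
Let pr A := on_event P A (fun=> 1).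
Let mean A := on_event P A (X s).
Let payoff (g : R -> R) A := on_event P A (fun w => g (X t1 w)).
Let FM A : F s A -> measurable A. Proof. exact: filtration_measurable. Qed.

(** The rectangle of [A] and [B] is cut according to the order of the two copies at [s], and
    [two_copies] is applied with [e = 1] on one part and [e = - 1] on the other. *)
Let lipschitz_events1 (g : R -> R) (k : R) A B :
  (forall x y, `|g x - g y| <= k * `|x - y|) -> F s A -> F s B ->
  pr A * payoff g B - payoff g A * pr B <=
  k * \int[PP]_z (\1_A z.1 * \1_B z.2 * `|X s z.2 - X s z.1|).
Proof.
move=> gk FA FB; have mA := FM FA; have mB := FM FB.
have ig := lipschitz_intble mX t10 gk.
have fF2 := filtration_F2 fF; have [sF2 F2m _] := fF2.
pose E := [set p | A p.1] `&` [set p : Omega * Omega | B p.2].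
have FE : F2 F s E.
  by apply: (salgI (sF2 _ s0)); [exact: F2_fst|exact: F2_snd].
pose O := [set p : Omega * Omega | 0 <= X s p.2 - X s p.1].
have FO : F2 F s O.
  have aXs : measurable_wrt (F s) (X s) by case: mX => + _ _; exact.
  have h : measurable_wrt (F2 F s) (fun p : Omega * Omega => X s p.2 - X s p.1).
    apply: (measurable_wrtB (sF2 _ s0)) => C mC.
      exact: (F2_snd fF s0 (aXs _ mC)).
    exact: (F2_fst fF s0 (aXs _ mC)).
  have := h `[0, +oo[%classic (measurable_itv _).
  rewrite (_ : _ @^-1` _ = O)//.
  by apply/seteqP; split => p /=; rewrite in_itv/= andbT.
have FEO : F2 F s (E `&` O) by apply: (salgI (sF2 _ s0)).
have FED : F2 F s (E `\` O) by apply: (salgD (sF2 _ s0)).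
have mEO := F2m _ s0 _ FEO; have mED := F2m _ s0 _ FED; have mE := F2m _ s0 _ FE.
have pos z : (E `&` O) z -> 0 <= 1 * (X s z.2 - X s z.1).
  by move=> [_]; rewrite mul1r.
have neg z : (E `\` O) z -> X s z.2 - X s z.1 <= 0.
  by move=> [_ /negP]; rewrite -ltNge => /ltW.
have neg' z : (E `\` O) z -> 0 <= - 1 * (X s z.2 - X s z.1).
  by move=> /neg; rewrite mulN1r oppr_ge0.
have h1 := two_copies fF mX sX aX s0 st1 gk FEO (normr1 R) pos.
have h2 := two_copies fF mX sX aX s0 st1 gk FED (normrN1 R) neg'.
rewrite mul1r in h1; rewrite mulN1r in h2.
have EE z : \1_A z.1 * \1_B z.2 = \1_E z :> R.
  by rewrite /E indicI.
have iXB : intble PP (fun z => X s z.2 - X s z.1).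
  exact: (intbleB (intble_snd P iXs) (intble_fst P iXs)).
have igB : intble PP (fun z => g (X t1 z.2) - g (X t1 z.1)).
  exact: (intbleB (intble_snd P ig) (intble_fst P ig)).
have iaXB := intble_abs iXB.
rewrite -rectangle_diff//.
under eq_Rintegral do rewrite EE.
under [X in _ <= _ * X]eq_Rintegral do rewrite EE.
rewrite -/(on_event PP E (fun z => g (X t1 z.2) - g (X t1 z.1))).
rewrite -/(on_event PP E (fun z => `|X s z.2 - X s z.1|)).
rewrite (on_event_split mE (F2m _ s0 _ FO) igB).
rewrite (on_event_split mE (F2m _ s0 _ FO) iaXB) mulrDr.
apply: lerD.
- apply: le_trans h1 _.
  rewrite le_eqVlt; apply/orP; left; apply/eqP; congr (_ * _).
  apply: eq_Rintegral => z _; rewrite indicE.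
  have [|_] := boolP (z \in _); last by rewrite !mul0r.
  by rewrite inE => -[_ zO]; rewrite ger0_norm.
- apply: le_trans h2 _.
  rewrite le_eqVlt; apply/orP; left; apply/eqP; congr (_ * _).
  rewrite -RintegralN; last exact: intble_indic.
  apply: eq_Rintegral => z _; rewrite indicE.
  have [|_] := boolP (z \in _); last by rewrite !mul0r oppr0.
  by rewrite inE => /neg zO; rewrite ler0_norm// mulrN.
Qed.

Lemma lipschitz_events (g : R -> R) (k : R) A B :
  (forall x y, `|g x - g y| <= k * `|x - y|) -> F s A -> F s B ->
  `|pr A * payoff g B - payoff g A * pr B| <=
  k * \int[PP]_z (\1_A z.1 * \1_B z.2 * `|X s z.2 - X s z.1|).
Proof.
move=> gk FA FB; have mA := FM FA; have mB := FM FB.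
rewrite ler_norml lipschitz_events1// andbT lerNl.
have gNk x y : `|(- g x) - (- g y)| <= k * `|x - y|.
  by rewrite -opprD normrN.
have := lipschitz_events1 gNk FA FB.
have ig := lipschitz_intble mX t10 gk.
have payN C : measurable C -> payoff (fun x => - g x) C = - payoff g C.
  move=> mC; rewrite -mulN1r -(on_eventZ _ mC ig).
  by congr on_event; apply/funext => w; rewrite mulN1r.
by rewrite !payN// mulrN mulNr opprK opprB addrC.
Qed.

(** Divided by [pr A * pr B], this bounds the difference of conditional payoffs by [k] times the
    difference of conditional means of [X s]. The multiplied form also covers null events. *)
Lemma lipschitz_ordered_events (g : R -> R) (k : R) A B :
  (forall x y, `|g x - g y| <= k * `|x - y|) -> F s A -> F s B ->
  (forall x y, A x -> B y -> X s x <= X s y) ->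
  `|pr A * payoff g B - payoff g A * pr B| <=
  k * (pr A * mean B - mean A * pr B).
Proof.
move=> gk FA FB AB; apply: le_trans (lipschitz_events gk FA FB) _.
rewrite -rectangle_diff//; [|exact: FM..].
rewrite le_eqVlt; apply/orP; left; apply/eqP; congr (_ * _).
apply: eq_Rintegral => -[x y] _ /=; rewrite !indicE.
have [|_] := boolP (x \in A); last by rewrite !mul0r.
have [|_] := boolP (y \in B); last by rewrite !mulr0 !mul0r.
by rewrite !inE => By Ax; rewrite ger0_norm// subr_ge0 AB.
Qed.

Lemma ordered_means A B : F s A -> F s B ->
  (forall x y, A x -> B y -> X s x <= X s y) ->
  0 <= pr A * mean B - mean A * pr B.
Proof.
move=> FA FB AB; rewrite -rectangle_diff//; [|exact: FM..].
apply: Rintegral_ge0 => -[x y] _ /=; rewrite !indicE.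
have [|_] := boolP (x \in A); last by rewrite !mul0r.
have [|_] := boolP (y \in B); last by rewrite !mulr0 !mul0r.
by rewrite !inE => By Ax; rewrite !mul1r subr_ge0 AB.
Qed.

Lemma lipschitz_close_events (g : R -> R) (k e : R) A B : 0 <= k ->
  (forall x y, `|g x - g y| <= k * `|x - y|) -> F s A -> F s B ->
  (forall x y, A x -> B y -> `|X s y - X s x| <= e) ->
  `|pr A * payoff g B - payoff g A * pr B| <= k * (e * (pr A * pr B)).
Proof.
move=> k0 gk FA FB AB; apply: le_trans (lipschitz_events gk FA FB) _.
have mA := FM FA; have mB := FM FB; have i1 := integrable_cst P 1.
have iA1 := intble_indic mA i1; have iB1 := intble_indic mB i1.
rewrite /pr /on_event -(Rintegral_prod iA1 iB1).
apply: ler_wpM2l => //; rewrite -RintegralZl//; last exact: (intble_prod iA1 iB1).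
have iX' : intble PP (fun z => X s z.2 - X s z.1).
  exact: (intbleB (intble_snd P iXs) (intble_fst P iXs)).
have miA : measurable_fun setT (\1_A : Omega -> R) by exact: measurable_indic.
have miB : measurable_fun setT (\1_B : Omega -> R) by exact: measurable_indic.
apply: le_Rintegral => //.
- apply: (@intbleM_bounded _ _ _ PP _ _ 1); last exact: intble_abs.
    apply: measurable_funM.
      exact: (measurableT_comp miA measurable_fst).
    exact: (measurableT_comp miB measurable_snd).
  by move=> z; rewrite normrM -[leRHS]mul1r ler_pM ?normr_indic.
- exact: (intbleZ e (intble_prod iA1 iB1)).
- move=> [x y] _ /=; rewrite !indicE.
  have [|_] := boolP (x \in A); last by rewrite !mul0r mulr0.
  have [|_] := boolP (y \in B); last by rewrite !(mulr0, mul0r).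
  by rewrite !inE => By Ax; rewrite !mul1r mulr1 AB.
Qed.

(** The left-hand side is minus the determinant of the rows [(pr, mean, payoff)] of [A], [B], [C]:
    by independence the integral of each monomial in [three_copies] factorizes. Means of [X s] are
    means of [X t1] by the martingale property. *)
Lemma convex_events (g : R -> R) (k : R) A B C :
  (forall x y, `|g x - g y| <= k * `|x - y|) ->
  (forall x y z, x <= y -> y <= z ->
    (z - x) * g y - (z - y) * g x - (y - x) * g z <= 0) ->
  F s A -> F s B -> F s C ->
  (forall x y, A x -> B y -> X s x <= X s y) ->
  (forall y z, B y -> C z -> X s y <= X s z) ->
  pr A * payoff g B * mean C - mean A * payoff g B * pr C
  - payoff g A * pr B * mean C + payoff g A * mean B * pr C
  - pr A * mean B * payoff g C + mean A * pr B * payoff g C <= 0.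
Proof.
move=> gk gconv FA FB FC AB BC.
have mA := FM FA; have mB := FM FB; have mC := FM FC.
have ig := lipschitz_intble mX t10 gk; have iX := process_intble mX t10.
have i1 := integrable_cst P 1.
have meanE D : F s D -> mean D = on_event P D (X t1).
  by move=> FD; rewrite (martingale_on_event fF mX s0 st1 FD).
rewrite !meanE//.
pose E := [set w : Omega * Omega * Omega | A w.1.1] `&`
  [set w | B w.1.2] `&` [set w | C w.2].
have fF3 := filtration_F3 fF; have [sF3 F3m _] := fF3.
have FE : F3 F s E.
  apply: (salgI (sF3 _ s0)); last exact: F3_3.
  by apply: (salgI (sF3 _ s0)); [exact: F3_1|exact: F3_2].
have Eord w : E w -> X s w.1.1 <= X s w.1.2 /\ X s w.1.2 <= X s w.2.
  by move=> [[Aw Bw] Cw]; split; [exact: AB|exact: BC].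
apply: le_trans (three_copies fF mX sX aX s0 st1 gk gconv FE Eord).
pose PPP := prob_prod PP P.
pose gX := fun w => g (X t1 w).
pose T (f h l : Omega -> R) (w : Omega * Omega * Omega) :=
  (\1_A w.1.1 * f w.1.1) * (\1_B w.1.2 * h w.1.2) * (\1_C w.2 * l w.2).
have iT f h l : intble P f -> intble P h -> intble P l -> intble PPP (T f h l).
  move=> iF ih il; have iA := intble_indic mA iF; have iB := intble_indic mB ih.
  exact: (intble_prod (intble_prod iA iB) (intble_indic mC il)).
have IT f h l : intble P f -> intble P h -> intble P l ->
    \int[PPP]_w T f h l w = on_event P A f * on_event P B h * on_event P C l.
  move=> iF ih il; have iA := intble_indic mA iF; have iB := intble_indic mB ih.
  rewrite (Rintegral_prod (intble_prod iA iB) (intble_indic mC il)).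
  by rewrite (Rintegral_prod iA iB).
have igX : intble P gX by [].
rewrite le_eqVlt; apply/orP; left; apply/eqP.
transitivity (\int[PPP]_w (T (fun=> 1%R) gX (X t1) w - T (X t1) gX (fun=> 1%R) w
  - T gX (fun=> 1%R) (X t1) w + T gX (X t1) (fun=> 1%R) w
  - T (fun=> 1%R) (X t1) gX w + T (X t1) (fun=> 1%R) gX w)).
  have j1 := iT _ _ _ i1 igX iX; have j2 := iT _ _ _ iX igX i1.
  have j3 := iT _ _ _ igX i1 iX; have j4 := iT _ _ _ igX iX i1.
  have j5 := iT _ _ _ i1 iX igX; have j6 := iT _ _ _ iX i1 igX.
  have j12 := intbleB j1 j2; have j13 := intbleB j12 j3.
  have j14 := intbleD j13 j4; have j15 := intbleB j14 j5.
  rewrite (RintegralD _ j15 j6)// (RintegralB _ j14 j5)// (RintegralD _ j13 j4)//.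
  rewrite (RintegralB _ j12 j3)// (RintegralB _ j1 j2)//.
  by rewrite !IT.
apply: eq_Rintegral => w _; rewrite /T /gX /E !indicI /=.
by rewrite -!/(\1_ _ _); ring.
Qed.

End event_inequalities.

(** * The value function *)

Section affine_minorant.
Context d (Omega : measurableType d) (R : realType).
Variables (P : probability Omega R) (F : R -> set (set Omega)).
Variable X : R -> {RV P >-> R}.
Hypotheses (fF : filtration F) (mX : martingale F X).
Hypotheses (sX : strong_markov F X) (aX : almost_continuous X).
Variables (s t1 : R).
Hypotheses (s0 : 0 <= s) (st1 : s <= t1).
Variables (g : R -> R) (k : R).
Hypothesis gk : forall x y, `|g x - g y| <= k * `|x - y|.
Hypothesis g_conv : forall x y z, x <= y -> y <= z ->
  (z - x) * g y - (z - y) * g x - (y - x) * g z <= 0.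

Let t10 : 0 <= t1. Proof. exact: le_trans s0 st1. Qed.
Let iXs := process_intble mX s0.
Let ig := lipschitz_intble mX t10 gk.
Let pr A := on_event P A (fun=> 1).
Let mean A := on_event P A (X s).
Let payoff A := on_event P A (fun w => g (X t1 w)).
Let FM A : F s A -> measurable A. Proof. exact: filtration_measurable. Qed.
Let pr_ge0 A : 0 <= pr A. Proof. exact: on_event_ge0. Qed.
Let sF : sigma_algebra setT (F s). Proof. by case: fF => /(_ s s0). Qed.

Let k0 : 0 <= k.
Proof.
have := gk 0 1; rewrite sub0r normrN1 mulr1; exact: le_trans.
Qed.

Variables (lo e : R).
Hypothesis e0 : 0 <= e.
Let A := [set w | lo <= X s w < lo + e].
Let below := [set w | X s w < lo].
Let above := [set w | lo + e <= X s w].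

Let aXs : measurable_wrt (F s) (X s). Proof. by case: mX => + _ _; exact. Qed.

Let FA : F s A.
Proof.
rewrite (_ : A = X s @^-1` `[lo, (lo + e)[%classic); first exact: aXs.
by apply/seteqP; split => w; rewrite /A /= in_itv.
Qed.

Let Fbelow : F s below.
Proof.
rewrite (_ : below = X s @^-1` `]-oo, lo[%classic); first exact: aXs.
by apply/seteqP; split => w; rewrite /below /= in_itv.
Qed.

Let Fabove : F s above.
Proof.
rewrite (_ : above = X s @^-1` `[lo + e, +oo[%classic); first exact: aXs.
by apply/seteqP; split => w; rewrite /above /= in_itv/= andbT.
Qed.

Hypothesis prA : 0 < pr A.

(** Up to the factor [pr A * pr B], the run and the rise of the chord joining the conditional means
    over [B] to those over [A]. *)
Let gap B := pr B * mean A - mean B * pr A.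
Let rise B := pr B * payoff A - payoff B * pr A.

Let left_order B : B `<=` below -> forall x y, B x -> A y -> X s x <= X s y.
Proof. by move=> Bb x y /Bb xlo /andP[ylo _]; apply/ltW/(lt_le_trans xlo). Qed.

Let right_order C : C `<=` above -> forall x y, A x -> C y -> X s x <= X s y.
Proof. by move=> Ca x y /andP[_ xhi] /Ca; apply: le_trans; exact: ltW. Qed.

(** The value [- k] keeps the set nonempty when [X s] has no mass below the interval. *)
Let slopes := [set r | r = - k \/
  exists B, [/\ F s B, B `<=` below, 0 < gap B & r = rise B / gap B]].

Let slopes_le r : slopes r -> r <= k.
Proof.
move=> [->|[B [FB Bb gB ->]]]; first by rewrite (le_trans _ k0)// oppr_le0.
rewrite ler_pdivrMr//; apply: le_trans (ler_norm _) _.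
exact: (lipschitz_ordered_events fF mX sX aX s0 st1 gk FB FA (left_order Bb)).
Qed.

Let has_sup_slopes : has_sup slopes.
Proof. by split; [exists (- k); left|exists k => r /slopes_le]. Qed.

Let lambda := sup slopes.

Let lambda_le r : slopes r -> r <= lambda.
Proof. by apply: ub_le_sup; case: has_sup_slopes. Qed.

Let lambda_bound : `|lambda| <= k.
Proof.
rewrite ler_norml lambda_le/=; last by left.
by apply: ge_sup => [|r /slopes_le//]; case: has_sup_slopes.
Qed.

(** The line of slope [lambda] through the conditional means over [A], lowered by [2 * k * e]. *)
Let c0 := (payoff A - lambda * mean A) / pr A - 2 * k * e.

Let c0E : c0 * pr A = payoff A - lambda * mean A - 2 * k * e * pr A.
Proof. by rewrite /c0 mulrBl divfK// gt_eqF. Qed.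

Let criterion B : rise B <= lambda * gap B + 2 * k * e * (pr A * pr B) ->
  lambda * mean B + c0 * pr B <= payoff B.
Proof.
move=> h; rewrite -(ler_pM2r prA) mulrDl -[c0 * _ * _]mulrA [pr B * _]mulrC.
rewrite [c0 * _]mulrA c0E; move: h; rewrite /rise /gap; lra.
Qed.

Let slack_ge0 B : 0 <= 2 * k * e * (pr A * pr B).
Proof. by rewrite !mulr_ge0. Qed.

(** [lambda] dominates every chord slope from the left. A chord without run has no rise either, by
    the Lipschitz bound. *)
Let minorant_below B : F s B -> B `<=` below ->
  lambda * mean B + c0 * pr B <= payoff B.
Proof.
move=> FB Bb; apply: criterion.
have := lipschitz_ordered_events fF mX sX aX s0 st1 gk FB FA (left_order Bb).
have := ordered_means fF mX s0 FB FA (left_order Bb).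
rewrite -/(gap B) -/(rise B) le_eqVlt => /predU1P[<-|gB].
  by rewrite !mulr0 normr_le0 add0r => /eqP ->.
move=> _; have : rise B / gap B <= lambda.
  by apply: lambda_le; right; exists B; split.
rewrite ler_pdivrMr// => h; apply: le_trans h _.
by rewrite lerDl.
Qed.

(** [lambda] must not exceed the chord slope to [C]: for chords from the left this is
    [convex_events], for [- k] the Lipschitz bound. Here [gap C] is nonpositive, so divisions
    reverse inequalities. *)
Let minorant_above C : F s C -> C `<=` above ->
  lambda * mean C + c0 * pr C <= payoff C.
Proof.
move=> FC Ca; apply: criterion.
rewrite -[leLHS]addr0; apply: lerD => //.
have := lipschitz_ordered_events fF mX sX aX s0 st1 gk FA FC (right_order Ca).
have := ordered_means fF mX s0 FA FC (right_order Ca).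
rewrite -/(pr A) -/(pr C) -/(mean A) -/(mean C) -/(payoff A) -/(payoff C).
rewrite (_ : pr A * mean C - _ = - gap C); last by rewrite /gap; ring.
rewrite (_ : pr A * payoff C - _ = - rise C); last by rewrite /rise; ring.
rewrite le_eqVlt => /predU1P[gC|gC].
  rewrite -gC mulr0 normr_le0 oppr_eq0 => /eqP ->.
  by rewrite -[gap C]opprK -gC oppr0 mulr0.
move=> hk; suff : lambda <= rise C / gap C.
  by rewrite ler_ndivlMr// -oppr_gt0.
apply: ge_sup => [|r]; first by case: has_sup_slopes.
have gC' : gap C < 0 by rewrite -oppr_gt0.
move=> [->|[B [FB Bb gB ->]]]; rewrite ler_ndivlMr//.
  by rewrite mulNr -mulrN; apply: le_trans hk; rewrite normrN ler_norm.
have := convex_events fF mX sX aX s0 st1 gk g_conv FB FA FC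
  (left_order Bb) (right_order Ca).
rewrite -/(pr A) -/(pr B) -/(pr C) -/(mean A) -/(mean B) -/(mean C).
rewrite -/(payoff A) -/(payoff B) -/(payoff C) => dt.
rewrite mulrAC ler_pdivlMr// -subr_ge0.
(* Cross-multiplied, the comparison of the two slopes is the determinant inequality times [pr A]. *)
rewrite (_ : _ - _ = - (pr A * (pr B * payoff A * mean C - mean B * payoff A * pr C
  - payoff B * pr A * mean C + payoff B * mean A * pr C
  - pr B * mean A * payoff C + mean B * pr A * payoff C))).
  by rewrite oppr_ge0 pmulr_rle0.
by rewrite /rise /gap; ring.
Qed.

(** Both [rise B] and [lambda * gap B] are at most [k * e * (pr A * pr B)] in absolute value, which
    is the origin of the loss [2 * k * e]. The bound on [gap B] is the closeness lemma for the
    identity payoff. *)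
Let minorant_inside B : F s B -> B `<=` A ->
  lambda * mean B + c0 * pr B <= payoff B.
Proof.
move=> FB BA; apply: criterion.
have close x y : A x -> B y -> `|X s y - X s x| <= e.
  by move=> /andP[? ?] /BA/andP[? ?]; rewrite ler_norml; lra.
have h1 := lipschitz_close_events fF mX sX aX s0 st1 k0 gk FA FB close.
have idk x y : `|(x : R) - y| <= 1 * `|x - y| by rewrite mul1r.
have := lipschitz_close_events fF mX sX aX s0 st1 ler01 idk FA FB close.
rewrite !(martingale_on_event fF mX s0 st1)// -/(mean A) -/(mean B) mul1r => h2.
move: h1 h2; rewrite -/(pr A) -/(pr B) -/(payoff A) -/(payoff B).
rewrite (_ : pr A * mean B - _ = - gap B); last by rewrite /gap; ring.
rewrite (_ : pr A * payoff B - _ = - rise B); last by rewrite /rise; ring.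
rewrite !normrN => h1 h2.
have h3 : `|lambda * gap B| <= k * (e * (pr A * pr B)).
  by rewrite normrM ler_pM.
move: h1 h3; rewrite !ler_norml => /andP[_ h1] /andP[h3 _]; lra.
Qed.

(* The slope is the supremum of the slopes of chords coming from the left; the
   loss [2 * k * e] absorbs the variation inside the interval. *)
Lemma affine_minorant : exists l c : R,
  [/\ `|l| <= k,
      forall B, F s B -> on_event P B (fun w => l * X s w + c) <= payoff B &
      payoff A - 2 * k * e * pr A <= on_event P A (fun w => l * X s w + c)].
Proof.
have affE B : F s B ->
    on_event P B (fun w => lambda * X s w + c0) = lambda * mean B + c0 * pr B.
  move=> FB; have mB := FM FB; have i1 := integrable_cst P 1.
  rewrite -(on_eventZ lambda mB iXs) -(on_eventZ c0 mB i1).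
  rewrite -on_eventD//; [|exact: intbleZ..].
  by congr on_event; apply/funext => w; rewrite mulr1.
exists lambda, c0; split => //; last by rewrite affE// c0E; lra.
move=> B FB; rewrite affE//; have mB := FM FB.
have i1 := integrable_cst P 1.
have FB1 := salgI sF FB Fbelow; have FBD := salgD sF FB Fbelow.
have FB2 := salgI sF FBD Fabove; have FB3 := salgD sF FBD Fabove.
have split_event f : intble P f -> on_event P B f =
    on_event P (B `&` below) f + (on_event P ((B `\` below) `&` above) f +
    on_event P ((B `\` below) `\` above) f).
  move=> iF; rewrite (on_event_split mB (FM Fbelow) iF).
  by rewrite (on_event_split (FM FBD) (FM Fabove) iF).
rewrite /mean /pr /payoff !split_event//.
have h1 : lambda * mean (B `&` below) + c0 * pr (B `&` below) <= payoff (B `&` below).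
  by apply: minorant_below => // w [].
have h2 := minorant_above FB2 (@subIsetr _ _ _).
have h3 : lambda * mean ((B `\` below) `\` above) +
    c0 * pr ((B `\` below) `\` above) <= payoff ((B `\` below) `\` above).
  apply: minorant_inside => // w [[_ /negP wb] /negP wa].
  by apply/andP; split; [rewrite leNgt|rewrite ltNge].
move: h1 h2 h3; rewrite /mean /pr /payoff; lra.
Qed.

End affine_minorant.

(** * Convex functions on the line *)

Section convexity.
Variable R : realType.
Implicit Types (h g : R -> R) (k : R).

Definition lipschitz_with k h := forall x y, `|h x - h y| <= k * `|x - y|.

(** Convexity cleared of denominators, a rearrangement of the sign condition on the determinant. *)
Definition below_chords h := forall x y z, x <= y -> y <= z ->
  (z - x) * h y <= (z - y) * h x + (y - x) * h z.

Let convE (p : {i01 R}) (a b : convex_lmodType R^o) :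
  conv p a b = p%:num * a + (1 - p%:num) * b.
Proof. by []. Qed.

Let convE' (p : {i01 R}) (a b : R^o) :
  conv p a b = p%:num * a + (1 - p%:num) * b.
Proof. by []. Qed.

Lemma convex_below_chords h :
  convex_function (E := R^o) setT h -> below_chords h.
Proof.
move=> ch x y z xy yz; have [xz|xz] := eqVneq x z.
  have -> : y = x by apply/eqP; rewrite eq_le xy xz yz.
  by rewrite -xz !subrr !mul0r addr0.
have xz0 : 0 < z - x by rewrite subr_gt0 lt_neqAle xz (le_trans xy).
have t0 : 0 <= (z - y) / (z - x) by rewrite divr_ge0 ?subr_ge0// ltW// -subr_gt0.
have t1 : (z - y) / (z - x) <= 1 by rewrite ler_pdivrMr// mul1r lerD2l lerN2.
have := ch (Itv01 t0 t1) x z (in_setT _) (in_setT _).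
rewrite convE convE' /=.
set t := (z - y) / (z - x).
have tE : t * (z - x) = z - y by rewrite /t divfK// gt_eqF.
have yE : y = z - t * (z - x) by rewrite tE; ring.
rewrite (_ : t * x + (1 - t) * z = y); last by rewrite yE; ring.
rewrite -(ler_pM2l xz0) => /le_trans; apply.
by rewrite le_eqVlt; apply/orP; left; apply/eqP; rewrite yE; ring.
Qed.

Lemma below_chords_convex h :
  below_chords h -> convex_function (E := R^o) setT h.
Proof.
move=> bh t x y _ _; rewrite convE convE'.
have t0 : 0 <= t%:num by [].
have t1 : t%:num <= 1 by [].
move: (t%:num) t0 t1 => {}t t0 t1.
wlog xy : t t0 t1 x y / x <= y.
  move=> wl; have [xy|/ltW yx] := leP x y; first exact: wl.
  have := wl (1 - t) _ _ y x yx; rewrite subr_ge0 lerBlDr lerDl t1 t0.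
  by rewrite subKr [_ + t * x]addrC [_ + t * h x]addrC; apply.
have [->|xy'] := eqVneq x y.
  by rewrite -!mulrDl (addrC t) subrK !mul1r.
have xy0 : 0 < y - x by rewrite subr_gt0 lt_neqAle xy'.
have h1 : x <= t * x + (1 - t) * y.
  rewrite -subr_ge0 (_ : _ - _ = (1 - t) * (y - x)); last by ring.
  by rewrite mulr_ge0 ?subr_ge0.
have h2 : t * x + (1 - t) * y <= y.
  rewrite -subr_ge0 (_ : _ - _ = t * (y - x)); last by ring.
  by rewrite mulr_ge0 ?subr_ge0.
rewrite -(ler_pM2l xy0); apply: le_trans (bh _ _ _ h1 h2) _.
rewrite le_eqVlt; apply/orP; left; apply/eqP; ring.
Qed.

(** The slope is the supremum of the chord slopes from the left, as in [affine_minorant] but without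
    loss. *)
Lemma subgradient h k x : below_chords h -> lipschitz_with k h ->
  exists2 l, `|l| <= k & forall y, h x + l * (y - x) <= h y.
Proof.
move=> bh lh; pose S := [set (h x - h y) / (x - y) | y in [set y | y < x]].
have S_bound r : S r -> `|r| <= k.
  move=> [y /= yx <-]; rewrite normrM normfV.
  have xy0 : 0 < `|x - y| by rewrite normr_gt0 subr_eq0 gt_eqF.
  by rewrite ler_pdivrMr.
have Sx : S ((h x - h (x - 1)) / (x - (x - 1))).
  by exists (x - 1) => //=; rewrite ltrBlDr ltrDl.
have Sup : has_sup S.
  split; first by exists ((h x - h (x - 1)) / (x - (x - 1))).
  by exists k => r /S_bound; exact/le_trans/ler_norm.
have [Sne Sub] := Sup.
exists (sup S).
  rewrite ler_norml; apply/andP; split.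
    apply: le_trans (ub_le_sup Sub Sx); move: (S_bound _ Sx).
    by rewrite ler_norml => /andP[].
  by apply: ge_sup => // r /S_bound; exact/le_trans/ler_norm.
move=> y; have [xy|yx|<-] := ltgtP x y; last by rewrite subrr mulr0 addr0.
  have yx0 : 0 < y - x by rewrite subr_gt0.
  rewrite -lerBrDl -ler_pdivlMr//; apply: ge_sup => // _ [z /= zx <-].
  have xz0 : 0 < x - z by rewrite subr_gt0.
  rewrite ler_pdivrMr// mulrAC ler_pdivlMr//.
  have := bh z x y (ltW zx) (ltW xy); lra.
have xy0 : 0 < x - y by rewrite subr_gt0.
have : (h x - h y) / (x - y) <= sup S by apply: ub_le_sup => //; exists y.
rewrite ler_pdivrMr//; lra.
Qed.

End convexity.

Section strip_limits.
Context d (Omega : measurableType d) (R : realType).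
Variable P : probability Omega R.

(** An error [c * e] on every strip adds up to [c * e] over a probability space, so local
    inequalities up to oscillation are enough. *)
Lemma Rintegral_strips_ge0 (V U : Omega -> R) (c : R) :
  measurable_fun setT V -> intble P U -> 0 <= c ->
  (forall e z, 0 < e ->
    0 <= on_event P (strip V e z) (fun w => U w + c * e)) ->
  0 <= \int[P]_w U w.
Proof.
move=> mV iU c0 H; apply/ler_addgt0Pr => r r0.
have c1 : 0 < c + 1 by rewrite ltr_wpDl.
pose e := r / (c + 1); have e0 : 0 < e by rewrite divr_gt0.
have : 0 <= \int[P]_w (U w + c * e).
  apply: (Rintegral_strip_ge0 e0 mV).
    by apply: intbleD => //; exact: integrable_cst.
  by move=> z; rewrite Rintegral_indic; exact: H.
rewrite RintegralD//; last exact: integrable_cst.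
rewrite Rintegral_prob_cst => /le_trans; apply; rewrite lerD2l.
by rewrite /e mulrA ler_pdivrMr// mulrC ler_pM2l// lerDl.
Qed.

End strip_limits.

(** * The supremum of the convex minorants *)

Section value_function.
Context d (Omega : measurableType d) (R : realType).
Variables (P : probability Omega R) (F : R -> set (set Omega)).
Variable X : R -> {RV P >-> R}.
Hypotheses (fF : filtration F) (mX : martingale F X).
Hypotheses (sX : strong_markov F X) (aX : almost_continuous X).
Variables (g : R -> R) (k t1 : R).
Hypotheses (gk : lipschitz_with k g) (cg : below_chords g) (t10 : 0 <= t1).

Let k0 : 0 <= k.
Proof. by have := gk 0 1; rewrite sub0r normrN1 mulr1; exact: le_trans. Qed.

Let FM s A : 0 <= s -> F s A -> measurable A.
Proof. exact: filtration_measurable. Qed.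

Let aXs s : 0 <= s -> measurable_wrt (F s) (X s).
Proof. by case: mX => + _ _; exact. Qed.

Let F_strip s e z : 0 <= s -> F s (strip (X s) e z).
Proof.
move=> s0; rewrite (_ : strip _ _ _ =
  X s @^-1` `[z%:~R * e, (z + 1)%:~R * e[%classic); first exact: aXs.
by apply/seteqP; split => w; rewrite /strip /= in_itv.
Qed.

Let strip_near s e z w : strip (X s) e z w -> `|X s w - z%:~R * e| <= e.
Proof.
move=> /andP[]; rewrite intrD mulrDl mul1r => h1 h2.
by rewrite ger0_norm ?subr_ge0//; lra.
Qed.

(** On a strip around [x] a single subgradient at [x] is used. Its increment [q] integrates to 0 by
    the martingale property; replacing [X s] by [x] costs [k * e] in [h] and [k * e] in the linear
    term, hence [2 * k]. *)
Lemma conditional_jensen s t h A : 0 <= s -> s <= t ->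
  below_chords h -> lipschitz_with k h -> F s A ->
  on_event P A (fun w => h (X s w)) <= on_event P A (fun w => h (X t w)).
Proof.
move=> s0 st bh lh FA; have t0 := le_trans s0 st.
have mA := FM s0 FA.
have ihs := lipschitz_intble mX s0 lh; have iht := lipschitz_intble mX t0 lh.
have iXs := process_intble mX s0; have iXt := process_intble mX t0.
rewrite -subr_ge0 -on_eventB//.
apply: (@Rintegral_strips_ge0 _ _ _ _ (X s) _ (2 * k)) => //.
- by apply: intble_indic => //; exact: intbleB.
- by rewrite mulr_ge0.
move=> e z e0; set S := strip _ _ _.
have FS : F s S by exact: F_strip.
have [sF _ _] := fF.
have FAS := salgI (sF _ s0) FA FS; have mAS := FM s0 FAS; have mS := FM s0 FS.
pose x := z%:~R * e; have [l lk lx] := subgradient x bh lh.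
have near w : S w -> `|X s w - x| <= e by exact: strip_near.
have hX w : S w -> h (X s w) <= h x + k * e.
  move=> /near Xx; rewrite -lerBlDl; apply: le_trans (ler_norm _) _.
  by apply: le_trans (lh _ _) _; exact: ler_wpM2l.
have lX w : S w -> - (k * e) <= l * (X s w - x).
  move=> /near Xx; have : `|l * (X s w - x)| <= k * e by rewrite normrM ler_pM.
  by rewrite ler_norml => /andP[].
pose q w := l * (X t w - X s w).
have iq : intble P q by exact/intbleZ/intbleB.
have q0 : on_event P (A `&` S) q = 0.
  rewrite on_eventZ//; last exact: intbleB.
  by rewrite on_eventB// (martingale_on_event fF mX s0 st FAS) subrr mulr0.
have iU : intble P (fun w => \1_A w * (h (X t w) - h (X s w)) + 2 * k * e).
  apply: intbleD; last exact: integrable_cst.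
  by apply: intble_indic => //; exact: intbleB.
rewrite -q0 /on_event; apply: le_Rintegral => //; [exact: intble_indic..|].
move=> w _; rewrite indicI /= !indicE.
have [wS|_] := boolP (w \in S); last by rewrite mulr0 !mul0r.
rewrite inE in wS; have := hX w wS; have := lX w wS; have := lx (X t w).
have ke0 : 0 <= k * e by rewrite mulr_ge0// ltW.
case: (w \in A); rewrite !(mul1r, mulr1, mul0r, mulr0) /q; first by lra.
by move=> *; rewrite add0r -mulrA mulr_ge0.
Qed.

(** The comparison with [E[g(X T) | F s]] in integrated form. The common Lipschitz constant bounds
    the supremum and makes it Lipschitz too. *)
Definition convex_minorant s h := [/\ below_chords h, lipschitz_with k h &
  forall A, F s A ->
    on_event P A (fun w => h (X s w)) <= on_event P A (fun w => g (X t1 w))].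

Definition value s x := sup [set h x | h in convex_minorant s].

Section at_time.
Variable s : R.
Hypotheses (s0 : 0 <= s) (st1 : s <= t1).

Let iXs : intble P (X s) := process_intble mX s0.
Let igX : intble P (fun w => g (X t1 w)) := lipschitz_intble mX t10 gk.
Let sF : sigma_algebra setT (F s). Proof. by case: fF => + _ _; apply. Qed.

Let g_minorant : convex_minorant s g.
Proof. by split => // A; exact: conditional_jensen. Qed.

(** [g] itself competes, by Jensen's inequality. The upper bound integrates
    [h x <= h (X s) + k * |x - X s|]. *)
Let values_has_sup x : has_sup [set h x | h in convex_minorant s].
Proof.
split; first by exists (g x), g.
exists (on_event P setT (fun w => g (X t1 w)) + k * \int[P]_w `|x - X s w|).
move=> _ [h [bh lh hle] <-].
have iaX : intble P (fun w => `|x - X s w|).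
  by apply/intble_abs/intbleB => //; exact: integrable_cst.
have ihX := lipschitz_intble mX s0 lh.
have := hle _ (salgT sF); rewrite -(lerD2r (k * \int[P]_w `|x - X s w|)).
apply: le_trans; rewrite on_event_setT -RintegralZl//.
rewrite -RintegralD//; last exact: intbleZ.
rewrite -[leLHS](Rintegral_prob_cst P); apply: le_Rintegral => //.
- exact: integrable_cst.
- exact/intbleD/intbleZ.
- by move=> w _; rewrite -lerBlDl; exact: le_trans (ler_norm _) (lh _ _).
Qed.

Lemma value_ge h x : convex_minorant s h -> h x <= value s x.
Proof. by move=> mh; apply: ub_le_sup; [case: (values_has_sup x)|exists h]. Qed.

Let value_le x y : (forall h, convex_minorant s h -> h x <= y) -> value s x <= y.
Proof.
move=> hy; apply: ge_sup; first by case: (values_has_sup x).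
by move=> _ [h mh <-]; exact: hy.
Qed.

Let value_below_chords : below_chords (value s).
Proof.
move=> x y z xy yz; have [xz|xz] := eqVneq x z.
  have -> : y = x by apply/eqP; rewrite eq_le xy xz yz.
  by rewrite -xz !subrr !mul0r addr0.
have xz0 : 0 < z - x by rewrite subr_gt0 lt_neqAle xz (le_trans xy).
rewrite mulrC -ler_pdivlMr//; apply: value_le => h mh.
rewrite ler_pdivlMr// mulrC; case: (mh) => bh _ _.
apply: le_trans (bh x y z xy yz) _.
by apply: lerD; apply: ler_wpM2l; rewrite ?subr_ge0//; exact: value_ge.
Qed.

Let value_lipschitz : lipschitz_with k (value s).
Proof.
have half x y : value s x - value s y <= k * `|x - y|.
  rewrite lerBlDr; apply: value_le => h mh; case: (mh) => _ lh _.
  rewrite -lerBlDl; apply: le_trans (value_ge y mh); rewrite lerBlDr -lerBlDl.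
  exact: le_trans (ler_norm _) (lh _ _).
by move=> x y; rewrite ler_norml half andbT lerNl opprB distrC half.
Qed.

Let ivX : intble P (fun w => value s (X s w)) := lipschitz_intble mX s0 value_lipschitz.

(** The supremum runs over an uncountable family, but on each strip one competitor suffices: [h]
    chosen within [e] of the supremum at [x]. Moving from [x] to [X s] costs [k * e] for [h] and
    again for [value s], hence [2 * k + 1]. *)
Lemma value_minorant : convex_minorant s (value s).
Proof.
split => // A FA; have mA := FM s0 FA.
rewrite -subr_ge0 -on_eventB//.
apply: (@Rintegral_strips_ge0 _ _ _ _ (X s) _ (2 * k + 1)) => //.
- by apply: intble_indic => //; exact: intbleB.
- by rewrite addr_ge0// mulr_ge0.
move=> e z e0; set S := strip _ _ _.
have FS : F s S by exact: F_strip.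
have FAS := salgI sF FA FS; have mAS := FM s0 FAS; have mS := FM s0 FS.
pose x := z%:~R * e.
have [_ [h mh <-] hx] := sup_adherent e0 (values_has_sup x).
rewrite -/(value s x) in hx; have [bh lh hle] := mh.
have ihX := lipschitz_intble mX s0 lh.
have near w : S w -> `|X s w - x| <= e by exact: strip_near.
have close f w : lipschitz_with k f -> S w -> `|f (X s w) - f x| <= k * e.
  by move=> lf /near Xx; apply: le_trans (lf _ _) _; exact: ler_wpM2l.
have iU : intble P (fun w => \1_A w * (g (X t1 w) - value s (X s w)) + (2 * k + 1) * e).
  apply: intbleD; last exact: integrable_cst.
  by apply: intble_indic => //; exact: intbleB.
rewrite (@le_trans _ _ (on_event P (A `&` S) (fun w => g (X t1 w) - h (X s w))))//.
  by rewrite on_eventB// subr_ge0 hle.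
apply: le_Rintegral => //.
- by apply: intble_indic => //; exact: intbleB.
- exact: intble_indic.
move=> w _; rewrite indicI /= !indicE.
have [wS|_] := boolP (w \in S); last by rewrite mulr0 !mul0r.
rewrite inE in wS; have := close h w lh wS; have := close _ w value_lipschitz wS.
have ke0 : 0 <= (2 * k + 1) * e by rewrite mulr_ge0 ?(ltW e0)// addr_ge0// mulr_ge0.
rewrite !ler_norml => /andP[_ h1] /andP[h2 _].
by case: (w \in A); rewrite !(mul1r, mulr1, mul0r, mulr0); lra.
Qed.

(** On a strip of positive probability [affine_minorant] supplies a competitor losing at most
    [2 * k * e] per unit of mass; a null strip contributes nothing. *)
Let value_total : on_event P setT (fun w => g (X t1 w)) <=
  on_event P setT (fun w => value s (X s w)).
Proof.
rewrite -subr_ge0 -on_eventB// on_event_setT.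
apply: (@Rintegral_strips_ge0 _ _ _ _ (X s) _ (2 * k)) => //.
- exact: intbleB.
- by rewrite mulr_ge0.
move=> e z e0; set S := strip _ _ _.
have FS : F s S by exact: F_strip.
have mS := FM s0 FS; have i1 := integrable_cst P 1.
have iB := intbleB ivX igX; have ic := integrable_cst P (2 * k * e).
rewrite on_eventD//.
have -> : on_event P S (fun=> 2 * k * e) = 2 * k * e * on_event P S (fun=> 1).
  by rewrite -on_eventZ//; congr on_event; apply/funext => w; rewrite mulr1.
rewrite on_eventB//.
have prS0 : 0 <= on_event P S (fun=> 1) by apply: on_event_ge0 => w _.
move: prS0; rewrite le_eqVlt => /predU1P[pS|pS]; last first.
  have g_conv x y z' : x <= y -> y <= z' ->
      (z' - x) * g y - (z' - y) * g x - (y - x) * g z' <= 0.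
    by move=> xy yz; have := cg xy yz; lra.
  have SE : S = [set w | z%:~R * e <= X s w < z%:~R * e + e].
    by apply/seteqP; split => w; rewrite /S /strip /= intrD mulrDl mul1r.
  have pS' := pS; rewrite SE in pS'.
  have [l [c [lk lle lS]]] :=
    affine_minorant fF mX sX aX s0 st1 gk g_conv (ltW e0) pS'.
  rewrite -SE in lS.
  have ml : convex_minorant s (fun x => l * x + c).
    split => //.
      by move=> x y z' _ _; rewrite le_eqVlt; apply/orP; left; apply/eqP; ring.
    move=> x y; rewrite (_ : _ - _ = l * (x - y)); last by ring.
    by rewrite normrM ler_wpM2r.
  have : on_event P S (fun w => l * X s w + c) <=
      on_event P S (fun w => value s (X s w)).
    apply: on_event_le => //; last by move=> w _; exact: value_ge ml.
    by apply: intbleD; [exact: intbleZ|exact: integrable_cst].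
  move: lS; lra.
have null f : intble P f -> on_event P S f = 0.
  move=> iF; have ind0 w : 0 <= \1_S w * 1 :> R by rewrite mulr1 indicE.
have S0 := Rintegral_eq0_ae (intble_indic mS i1) ind0 (esym pS).
rewrite -[RHS](Rintegral_prob_cst P); apply: ae_eq_Rintegral.
- exact: (integrable_measurable (intble_indic mS iF)).
- exact: measurable_cst.
- by apply: filterS S0 => w; rewrite mulr1 => ->; rewrite mul0r.
by rewrite !null// subrr mulr0 addr0.
Qed.

(** The minorant inequality holds on [A] and on its complement, and the reverse one for their sum,
    so both are equalities. *)
Lemma value_on_event A : F s A ->
  on_event P A (fun w => value s (X s w)) = on_event P A (fun w => g (X t1 w)).
Proof.
move=> FA; have mA := FM s0 FA; have [_ _ vle] := value_minorant.
have FAC := salgD sF (salgT sF) FA; have FAT := salgI sF (salgT sF) FA.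
have h1 := vle _ FAT; have h2 := vle _ FAC.
have := value_total; rewrite (on_event_split measurableT mA igX).
rewrite (on_event_split measurableT mA ivX).
move: h1 h2; rewrite !setTI => h1 h2 h3; apply/eqP; rewrite eq_le h1/=; lra.
Qed.

Lemma value_convex : convex_function (E := R^o) setT (value s).
Proof. exact: below_chords_convex. Qed.

Lemma value_as_condexp :
  as_condexp P (F s) (fun w => g (X t1 w)) (fun w => value s (X s w)).
Proof.
exists (fun w => value s (X s w)); last by apply: aeW.
split => //.
- apply: (measurable_wrt_comp _ (aXs s0)); apply: continuous_measurable_fun.
  exact: lipschitz_continuous value_lipschitz.
- move=> A FA; have mA := FM s0 FA.
  rewrite !EFin_Rintegral// !(Rintegral_indic P A); congr EFin.
  exact: value_on_event.
Qed.

End at_time.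

Lemma value_decreasing s t x : 0 <= s -> s <= t -> t <= t1 ->
  value t x <= value s x.
Proof.
move=> s0 st tt1; have t0 := le_trans s0 st; have st1 := le_trans st tt1.
apply: value_ge => //; have [bv lv _] := value_minorant t0 tt1.
split => // A FA; apply: le_trans (conditional_jensen s0 st bv lv FA) _.
by rewrite value_on_event//; exact: filtration_le FA.
Qed.

End value_function.

Unset Implicit Arguments.

Theorem theorem1p6 (R : realType)
    (d : measure_display) (Omega : measurableType d) (P : probability Omega R)
    (F : R -> set (set Omega)) (hF : filtration F)
    (X : R -> {RV P >-> R})
    (hXmart : martingale F X)
    (hXdiff : almost_continuous_diffusion F X)
    (g : R -> R) (hgconv : convex_function (E := R^o) [set: R] g)
    (hglip : exists k : R, k.-lipschitz g)
    (T : R) (hT : 0 <= T) :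
  exists f : R -> R -> R,
    [/\ forall t : R, 0 <= t <= T -> convex_function (E := R^o) [set: R] (f t),
        forall s t x : R, 0 <= s -> s <= t -> t <= T -> f t x <= f s x &
        forall t : R, 0 <= t <= T ->
          as_condexp P (F t) (fun w => g (X T w)) (fun w => f t (X t w))].
Proof.
have [sX aX] := hXdiff; have [k gk] := hglip.
have lg : lipschitz_with k g by move=> x y; exact: (gk (x, y)).
have cg := convex_below_chords hgconv.
exists (value F X g k T); split.
- move=> t /andP[t0 tT]; exact: (value_convex hF hXmart lg cg t0 tT).
- move=> s t x; exact: (value_decreasing hF hXmart sX aX lg cg hT x).
- move=> t /andP[t0 tT].
  exact: (value_as_condexp hF hXmart sX aX lg cg hT t0 tT).
Qed.
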